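(* Let $\delta\in[0,1]$ and let $p_{UV}$ be the distribution of $n$ independent qubit erasure channels with parameter $\delta$: $V=(V_1,\dots,V_n)$ has i.i.d. Bernoulli$(\delta)$ entries, and conditional on $V=v$, $U$ is uniformly distributed over the $4^{|v|}$ vectors $u\in\mathbb{F}^{2n}$ with $u_i=u_{2n+1-i}=0$ for every $i\in[n]$ with $v_i=0$ (here $|v|$ is the number of ones in $v$). For $k\in\{0,\dots,n\}$, $r=k/n$, $m=n-k$: $$\epsilon^{conv}(p_{UV},r)=B\Big(n,1-\delta,n-\lfloor \tfrac m2\rfloor-1\Big)-2^m\Big(\tfrac{4-3\delta}{4}\Big)^nB\Big(n,\tfrac{4-4\delta}{4-3\delta},n-\lfloor\tfrac m2\rfloor-1\Big)$$ and $$\epsilon^{ach}(p_{UV},r)=\Big(1+\tfrac{1}{2^{m+1}}\Big)B\Big(n,1-\delta,n-\lfloor\tfrac m2\rfloor-1\Big)-\tfrac{1}{2^{m+1}}-\tfrac{2^m+1}{2}\Big(\tfrac{4-3\delta}{4}\Big)^nB\Big(n,\tfrac{4-4\delta}{4-3\delta},n-\lfloor\tfrac m2\rfloor-1\Big)+\tfrac{(1+3\delta)^n}{2^{m+1}}B\Big(n,\tfrac{4\delta}{1+3\delta},\lfloor\tfrac m2\rfloor\Big).$$ Moreover, for fixed $\delta$ and $\epsilon$ and sufficiently large $n$, $$R_{guess}(p_{UV},\epsilon)=1-2\delta+\frac{2\Phi^{-1}(\epsilon)\sqrt{\delta(1-\delta)}}{\sqrt n}+O\Big(\frac1n\Big)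.$$
   Context: $\mathbb{F}$ is the field with two elements, $e_{N,i}$ the standard basis vectors, $R_{2n}=\sum_{i=1}^{2n}e_{2n,i}e_{2n,2n+1-i}^{\top}$, $\mathrm{Sp}_{2n}=\{C:C^{\top}R_{2n}C=R_{2n}\}$. $B(n,p,i)=\sum_{i'=0}^{i}\binom{n}{i'}p^{i'}(1-p)^{n-i'}$ (an empty sum is $0$). $\Phi$ is the standard normal CDF. For a partition $n=m+k$, $C\in\mathrm{Sp}_{2n}$ and decoder $D$ (map from (value of $V$, syndrome in $\mathbb{F}^m$) to $\mathbb{F}^{2n}$), the probability of incorrect guess is $\Pr[D(V,\sum_{i=1}^m e_{m,i}e_{2n,i}^{\top}CU)\ne U]$. $R_{guess}(p_{UV},\epsilon)$ is the maximum $k/n$ such that some $(C,D)$ with $m=n-k$ has probability of incorrect guess at most $\epsilon$. Rank variable $J$: for each $v$, list $\mathbb{F}^{2n}$ as $\sigma(1,v),\dots,\sigma(2^{2n},v)$ in non-increasing order of $p_{UV}(\cdot,v)$ (ties arbitrary), and $\{J=j,V=v\}=\{U=\sigma(j,v),V=v\}$. Then $\epsilon^{conv}(p_{UV},r)=\Pr[J>2^m]$ and $\epsilon^{ach}(p_{UV},r)=\Pr[J>2^m]+\mathbb{E}[\mathbf{1}\{J\le2^m\}(J-1)2^{-m}]$.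
   Formalization: In R_guess, k = n − m may be negative (m ranges over 0,…,2n), since for δ > 1/2 and large n no k ≥ 0 is feasible and the maximum would be undefined; it is unchanged whenever some k ≥ 0 is feasible. ε is taken in (0,1) so that Φ^{-1}(ε) is finite. *)

(* Defs.v *)
From HB Require Import structures.
From mathcomp Require Import all_boot all_order all_algebra.
From mathcomp Require Import all_classical all_reals all_analysis.
Set Implicit Arguments. Unset Strict Implicit. Unset Printing Implicit Defensive.
Import Order.TTheory GRing.Theory Num.Theory.
Local Open Scope ring_scope.

(* The field with two elements. Vectors in F^N are column vectors 'cV_N.
   Indices are 0-based: paper index i in [1..N] corresponds to i-1. *)
Notation F := 'F_2.
Notation vecF N := ('cV[F]_N).

Definition Rmat (n : nat) : 'M[F]_(n.*2) :=
  \matrix_(i, j) (j == rev_ord i)%:R.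

Definition symplectic (n : nat) (C : 'M[F]_(n.*2)) : bool :=
  C^T *m Rmat n *m C == Rmat n.

Definition syndmat (m N : nat) : 'M[F]_(m, N) :=
  \matrix_(i, j) (val i == val j)%:R.

Definition wt (n : nat) (v : vecF n) : nat := #|[set i | v i 0 != 0]|.

Definition compat (n : nat) (u : vecF n.*2) (v : vecF n) : bool :=
  [forall i : 'I_n, (v i 0 == 0) ==>
     [forall j : 'I_(n.*2), ((val j == val i) || (val j == n.*2 - 1 - val i)%N)
        ==> (u j 0 == 0)]].

Section Defs.
Variable R : realType.

Definition pUV_erasure (n : nat) (delta : R) (u : vecF n.*2) (v : vecF n) : R :=
  delta ^+ wt v * (1 - delta) ^+ (n - wt v) *
  (if compat u v then (#|[set u' | compat u' v]|%:R)^-1 else 0).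

(* rk v u = J on the event {U=u, V=v}: for each v, rk v lists F^{2n}
   bijectively as 1..2^{2n} in non-increasing order of p(.,v)
   (ties broken arbitrarily). *)
Definition rank_order (n : nat) (p : vecF n.*2 -> vecF n -> R)
  (rk : vecF n -> vecF n.*2 -> nat) : Prop :=
  forall v, injective (rk v) /\
    (forall u, (1 <= rk v u <= 2 ^ n.*2)%N) /\
    (forall u u', (rk v u < rk v u')%N -> p u' v <= p u v).

Definition eps_conv (n m : nat) (p : vecF n.*2 -> vecF n -> R)
  (rk : vecF n -> vecF n.*2 -> nat) : R :=
  \sum_(v : vecF n) \sum_(u : vecF n.*2)
     (if (2 ^ m < rk v u)%N then p u v else 0).

Definition eps_ach (n m : nat) (p : vecF n.*2 -> vecF n -> R)
  (rk : vecF n -> vecF n.*2 -> nat) : R :=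
  eps_conv m p rk +
  \sum_(v : vecF n) \sum_(u : vecF n.*2)
     (if (rk v u <= 2 ^ m)%N then p u v * ((rk v u)%:R - 1) / (2 ^ m)%:R
      else 0).

Definition Bcdf (n : nat) (q : R) (i : int) : R :=
  match i with
  | Posz k => \sum_(i' < k.+1) ('C(n, i')%:R * q ^+ i' * (1 - q) ^+ (n - i'))
  | Negz _ => 0
  end.

Definition err_guess (n m : nat) (p : vecF n.*2 -> vecF n -> R)
  (C : 'M[F]_(n.*2)) (D : vecF n -> vecF m -> vecF n.*2) : R :=
  \sum_(v : vecF n) \sum_(u : vecF n.*2)
     (if D v (syndmat m n.*2 *m C *m u) != u then p u v else 0).

Definition feasible (n m : nat) (p : vecF n.*2 -> vecF n -> R) (eps : R)
  : Prop :=
  exists C : 'M[F]_(n.*2), symplectic C /\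
  exists D : vecF n -> vecF m -> vecF n.*2, err_guess p C D <= eps.

(* R_guess(p, eps) = max { k/n : k = n - m, m in [0, 2n] feasible }.
   (m = 2n is always feasible for eps >= 0, so the default -1 = (n-2n)/n
   never changes the value.) *)
Definition R_guess (n : nat) (p : vecF n.*2 -> vecF n -> R) (eps : R) : R :=
  \big[Order.max/(-1)]_(m < (n.*2).+1 | `[< feasible m p eps >])
     ((n%:R - (val m)%:R) / n%:R).

Definition Phi (x : R) : R := fine (normal_prob 0 1 `]-oo, x]).
Definition Phi_inv (e : R) : R := sup [set x | Phi x <= e].

End Defs.

Arguments pUV_erasure {R} n delta u v.
Arguments R_guess {R} n p eps.

(* Main.v *)
Require Import Defs.
From HB Require Import structures.
From mathcomp Require Import all_boot all_order all_algebra.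
From mathcomp Require Import all_classical all_reals all_analysis.
From mathcomp Require Import ring lra zify.
Import Order.TTheory GRing.Theory Num.Theory.
Import numFieldNormedType.Exports.
Local Open Scope ring_scope.

(** Given [V = v], the vector [U] is uniform on a subspace of size [4^|v|], so every
    quantity of the theorem is a binomial expectation of a function of [|v|]; the two
    exact formulas follow by counting ranks inside that subspace.

    For the rate, a decoder fed with an [m]-bit syndrome is right for at most [2^m] of
    the [4^|v|] candidates, while a random symplectic matrix, [Sp] being transitive on
    nonzero vectors (transvections), makes two candidates collide with probability at
    most [2^-m].  Since a binomial law has point masses [O(1/sqrt n)], both bounds equal
    [P(2|V| > m)] up to [O(1/sqrt n)].  Stein's method, run directly on the binomial law
    through [E((W - np) g(W)) = npq E(g(W' + 1) - g(W'))], compares this tail with [Phi]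
    up to [O(1/sqrt n)] in a bounded range, which locates the critical [m] up to [O(1)]. *)

(** * Erasure patterns and ranks *)

(** The target precision is [O(1)] in [m], hence [O(1)] in [|V|], whose standard deviation is of
    order [sqrt n]. An [O(1/sqrt n)] error in the tail is affordable because [Phi] has positive
    slope at the critical point: moving the threshold by a large enough constant outweighs it. The
    finite-length bounds differ from the plain tail by terms decaying geometrically in the distance
    of [|V|] from [m/2]; their total is bounded, so they cost only a constant number of point
    masses.

    The solution of Stein's equation has a kink where the indicator jumps. Only integer thresholds
    matter, so no unit step of the lattice straddles the kink and each step sees a smooth function;
    for thresholds in a bounded range every estimate reduces to the Mills ratio. Since the binomial
    identity links [n + 1] trials to [n], the law of [n] trials is paired throughout with the
    variance of [n + 1] trials, and returning to [n] costs [O(1)] in [m]. The variance vanishes at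
    [delta = 0] and [delta = 1], which are treated directly. *)

Lemma card_wt (n i : nat) : #|[set v : vecF n | wt v == i]| = 'C(n, i).
Proof.
pose f (v : vecF n) := [set j | v j 0 != 0].
have finj : injective f.
  move=> v1 v2 /setP e; apply/matrixP => j k; rewrite [k]ord1.
  have := e j; rewrite !inE.
  case: (v1 j 0) => -[|[|//]] h1; case: (v2 j 0) => -[|[|//]] h2 //= _;
    exact/val_inj.
rewrite -[in RHS](card_ord n) -card_draws -(card_imset _ finj).
congr #|pred_of_set _|; apply/setP => A; rewrite inE; apply/imsetP/eqP.
  by case=> v; rewrite inE => /eqP <- ->.
move=> cA; exists (\col_j (j \in A)%:R).
  rewrite inE; apply/eqP; rewrite -cA /wt; apply: eq_card => j.
  by rewrite !inE mxE; case: (j \in A).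
by apply/setP => j; rewrite !inE mxE; case: (j \in A).
Qed.

Lemma wt_le (n : nat) (v : vecF n) : (wt v <= n)%N.
Proof. by rewrite -[X in (_ <= X)%N](card_ord n) max_card. Qed.

Lemma sum_wt (R : nzRingType) (n : nat) (h : nat -> R) :
  \sum_(v : vecF n) h (wt v) = \sum_(i < n.+1) 'C(n, i)%:R * h i.
Proof.
rewrite (partition_big (fun v => inord (wt v) : 'I_n.+1) predT) //=.
apply: eq_bigr => i _; rewrite -card_wt mulr_natl -sumr_const.
apply: eq_big => [v|v /eqP <-].
  by rewrite inE -val_eqE /= inordK // ltnS wt_le.
by rewrite inordK // ltnS wt_le.
Qed.

Lemma card_vec_support (N : nat) (A : {set 'I_N}) :
  #|[set u : vecF N | [forall j, (j \notin A) ==> (u j 0 == 0)]]| = (2 ^ #|A|)%N.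
Proof.
have cF : #|F| = 2%N by rewrite card_Fp.
have <- : #|pffun_on (0 : F) (mem A) (mem [set: F])| = (2 ^ #|A|)%N.
  by rewrite card_pffun_on cardsT cF.
pose f (u : vecF N) := [ffun j => u j 0].
have finj : injective f.
  move=> u1 u2 /ffunP e; apply/matrixP => j k; rewrite [k]ord1.
  by have := e j; rewrite !ffunE.
rewrite -(card_imset _ finj); apply: eq_card => g.
apply/imsetP/pffun_onP.
  case=> u; rewrite inE => /forallP hu ->; split; last by move=> x; rewrite inE.
  apply/supportP => j jA; rewrite ffunE; apply/eqP.
  exact: (implyP (hu j)).
case=> /supportP hg _; exists (\col_j g j); last first.
  by apply/ffunP => j; rewrite ffunE mxE.
by rewrite inE; apply/forallP => j; apply/implyP => jA; rewrite mxE; apply/eqP/hg.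
Qed.

Lemma leq_self_double (n : nat) : (n <= n.*2)%N.
Proof. by rewrite -addnn leq_addr. Qed.

Definition lo_ord (n : nat) (i : 'I_n) : 'I_(n.*2) := widen_ord (leq_self_double n) i.

Lemma lo_ord_inj (n : nat) : injective (@lo_ord n).
Proof. by move=> i j /(congr1 val) /= /val_inj. Qed.

Definition erased_coords (n : nat) (v : vecF n) : {set 'I_(n.*2)} :=
  ~: ([set lo_ord n i | i in [set i | v i 0 == 0]]
   :|: [set rev_ord (lo_ord n i) | i in [set i | v i 0 == 0]]).

Lemma compatE (n : nat) (u : vecF n.*2) (v : vecF n) :
  compat u v = [forall j, (j \notin erased_coords n v) ==> (u j 0 == 0)].
Proof.
apply/forallP/forallP => h.
  move=> j; rewrite inE negbK; apply/implyP; rewrite inE => /orP[] /imsetP[i].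
    rewrite inE => vi ->; have /forallP := implyP (h i) vi.
    by move=> /(_ (lo_ord n i)) /implyP; apply; rewrite eqxx.
  rewrite inE => vi ->; have /forallP := implyP (h i) vi.
  move=> /(_ (rev_ord (lo_ord n i))) /implyP; apply => /=.
  by apply/orP; right; apply/eqP; lia.
move=> i; apply/implyP => vi; apply/forallP => j; apply/implyP => hj.
apply: (implyP (h j)); rewrite inE negbK inE; case/orP: hj => /eqP hj.
  apply/orP; left; apply/imsetP; exists i; first by rewrite inE.
  exact/val_inj.
apply/orP; right; apply/imsetP; exists i; first by rewrite inE.
by apply/val_inj => /=; move: hj => /=; lia.
Qed.

(** A coordinate below [n] never coincides with the mirror of another, so each unerased qubit
    removes exactly two coordinates. *)
Lemma card_erased_coords (n : nat) (v : vecF n) :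
  #|erased_coords n v| = (wt v).*2.
Proof.
rewrite /erased_coords cardsCs finset.setCK card_ord cardsU.
set Z := [set i | v i 0 == 0].
rewrite (card_imset _ (@lo_ord_inj n)).
rewrite (card_imset _ (inj_comp rev_ord_inj (@lo_ord_inj n))).
rewrite (_ : _ :&: _ = finset.set0) ?cards0.
  have cZ : (wt v + #|Z| = n)%N.
    rewrite addnC -[RHS](card_ord n) -(cardsC Z); congr addn.
    by apply: eq_card => i; rewrite !inE.
  lia.
apply/setP => j; rewrite !inE; apply/negP => /andP[/imsetP[i _ ->] /imsetP[k _]].
move=> /(congr1 val) /=; have := ltn_ord i; have := ltn_ord k; lia.
Qed.

Lemma card_compat (n : nat) (v : vecF n) :
  #|[set u | compat u v]| = (4 ^ wt v)%N.
Proof.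
rewrite (_ : 4 = 2 ^ 2)%N // -expnM mul2n -card_erased_coords -card_vec_support.
by apply: eq_card => u; rewrite !inE compatE.
Qed.

Lemma pUV_erasureE (R : realType) (n : nat) (delta : R) u (v : vecF n) :
  pUV_erasure n delta u v = delta ^+ wt v * (1 - delta) ^+ (n - wt v) *
    (if compat u v then (4 ^+ wt v)^-1 else 0).
Proof. by rewrite /pUV_erasure card_compat natrX. Qed.

(* Whatever the tie-breaking, the vectors compatible with [v] get the ranks 1, ..., 4^|v|. *)
Lemma sum_rank (R : realType) (n : nat) (delta : R)
    (rk : vecF n -> vecF n.*2 -> nat) (v : vecF n) (h : nat -> R) :
  0 <= delta <= 1 -> rank_order (pUV_erasure n delta) rk ->
  \sum_(u : vecF n.*2) pUV_erasure n delta u v * h (rk v u) =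
  delta ^+ wt v * (1 - delta) ^+ (n - wt v) / 4 ^+ wt v
    * \sum_(1 <= j < (4 ^ wt v).+1) h j.
Proof.
move=> /andP[d0 d1] /(_ v)[rinj [rrange rmono]].
set c := delta ^+ wt v * (1 - delta) ^+ (n - wt v).
have c0 : 0 <= c by rewrite mulr_ge0 // exprn_ge0 // subr_ge0.
(* When [delta] is 0 or 1, the pattern [v] may have probability zero; its ranking is then
   unconstrained, but both sides vanish. *)
move: c0; rewrite le_eqVlt => /orP[/eqP c0|c0].
  rewrite -c0 !mul0r big1 // => u _.
  by rewrite pUV_erasureE -/c -c0 !mul0r.
have pE u : pUV_erasure n delta u v = c * (if compat u v then (4 ^+ wt v)^-1 else 0).
  by rewrite pUV_erasureE.
have i4 : (0 : R) < (4 ^+ wt v)^-1 by rewrite invr_gt0 exprn_gt0.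
have first u u' : compat u v -> ~~ compat u' v -> (rk v u < rk v u')%N.
  move=> cu cu'; rewrite ltnNge; apply/negP => le.
  have lt : (rk v u' < rk v u)%N.
    rewrite ltn_neqAle le andbT; apply/eqP => /rinj e.
    by move: cu'; rewrite e cu.
  have := rmono _ _ lt; rewrite !pE cu (negbTE cu') mulr0.
  by rewrite leNgt mulr_gt0.
set S := [set u | compat u v].
have cS : #|S| = (4 ^ wt v)%N by exact: card_compat.
have permT : perm_eq (map (rk v) (enum {: vecF n.*2})) (iota 1 (2 ^ n.*2)).
  have sz : size (map (rk v) (enum {: vecF n.*2})) = (2 ^ n.*2)%N.
    rewrite size_map -cardT card_mx muln1; congr expn; exact: card_Fp.
  have un : uniq (map (rk v) (enum {: vecF n.*2})) by rewrite map_inj_uniq ?enum_uniq.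
  have sub : {subset map (rk v) (enum {: vecF n.*2}) <= iota 1 (2 ^ n.*2)}.
    by move=> j /mapP[u _ ->]; rewrite mem_iota add1n ltnS.
  rewrite uniq_perm ?iota_uniq //.
  by case: (uniq_min_size un sub); rewrite ?sz ?size_iota.
have permS : perm_eq (iota 1 (4 ^ wt v)) (map (rk v) (enum S)).
  have sz : size (map (rk v) (enum S)) = (4 ^ wt v)%N.
    by rewrite size_map -cardE.
  (* Pigeonhole: if a rank [j <= 4 ^ wt v] belonged to an incompatible vector, all [4 ^ wt v]
     compatible ones would have ranks below [j]. *)
  have sub : {subset iota 1 (4 ^ wt v) <= map (rk v) (enum S)}.
    move=> j; rewrite mem_iota add1n ltnS => /andP[j1 j4].
    have : j \in map (rk v) (enum {: vecF n.*2}).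
      rewrite (perm_mem permT) mem_iota j1 add1n ltnS (leq_trans j4) //.
      rewrite (_ : 4 = 2 ^ 2)%N // -expnM leq_exp2l // mul2n leq_double.
      exact: wt_le.
    case/mapP => u _ ej; apply/mapP; exists u => //; rewrite mem_enum inE.
    apply/negPn/negP => cu.
    have ub : {subset map (rk v) (enum S) <= iota 1 j.-1}.
      move=> k /mapP[u']; rewrite mem_enum inE => cu' ->.
      rewrite mem_iota add1n prednK // ej (first _ _ cu' cu) andbT.
      by have /andP[] := rrange u'.
    have un : uniq (map (rk v) (enum S)) by rewrite map_inj_uniq ?enum_uniq.
    have := uniq_leq_size un ub; rewrite sz size_iota; lia.
  apply: uniq_perm; first exact: iota_uniq.
    by rewrite map_inj_uniq ?enum_uniq.
  by case: (uniq_min_size (iota_uniq 1 (4 ^ wt v)) sub); rewrite ?sz ?size_iota.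
rewrite /index_iota subn1 /= (perm_big _ permS) big_map big_enum /=.
rewrite big_distrr /= [RHS]big_mkcond /=.
by apply: eq_bigr => u _; rewrite pE inE; case: ifP => _; rewrite ?mulr0 ?mul0r.
Qed.

(** * The standard normal distribution *)

Lemma MVT_is_derive {R : realType} (f df : R -> R) (a b : R) : a <= b ->
  (forall x, a <= x <= b -> is_derive x 1 f (df x)) ->
  exists2 c, a <= c <= b & f b - f a = df c * (b - a).
Proof.
move=> ab fdf.
have [||c cab e] := @MVT_segment R f df a b ab.
- by move=> x; rewrite in_itv /= => /andP[/ltW ax /ltW xb]; apply: fdf; rewrite ax.
- apply: derivable_within_continuous => x; rewrite in_itv /= => xab.
  by have [] := fdf x xab.
by exists c => //; move: cab; rewrite in_itv.
Qed.

Section Normal.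
Local Open Scope classical_set_scope.
Local Open Scope ring_scope.
Context {R : realType}.
Implicit Types x y z : R.

Definition phi : R -> R := normal_pdf 0 1.

Lemma phiE x : phi x = normal_peak 1 * expR (- x ^+ 2 / 2).
Proof.
by rewrite /phi normal_pdfE ?oner_neq0 // /normal_fun subr0 expr1n.
Qed.

Lemma phi_gt0 x : 0 < phi x.
Proof. by rewrite phiE mulr_gt0 ?expR_gt0 ?normal_peak_gt0 ?oner_neq0. Qed.

Lemma phiN x : phi (- x) = phi x.
Proof. by rewrite !phiE sqrrN. Qed.

Lemma phi_decr x y : `|x| <= `|y| -> phi y <= phi x.
Proof.
move=> xy; rewrite !phiE ler_pM2l ?normal_peak_gt0 ?oner_neq0 // ler_expR.
have : `|x| ^+ 2 <= `|y| ^+ 2 by rewrite ler_sqr ?nnegrE.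
rewrite !real_normK ?num_real //; lra.
Qed.

(** By unimodality the density is smallest at an end of an interval; this gives the slope constant
    in [Phi_growth]. *)
Lemma phi_bound x y z : x <= z <= y -> Num.min (phi x) (phi y) <= phi z.
Proof.
move=> /andP[xz zy]; rewrite ge_min; case: (leP 0 z) => z0; apply/orP.
  by right; apply: phi_decr; rewrite !ger0_norm // (le_trans z0).
left; apply: phi_decr; rewrite !ler0_norm ?lerN2 //; last exact: ltW.
exact: le_trans xz (ltW z0).
Qed.

Lemma is_derive_phi x : is_derive x 1 phi (- x * phi x).
Proof.
have -> : phi = (fun t => normal_peak 1 * expR (- t ^+ 2 / 2)).
  by apply/funext => t; rewrite phiE.
apply: is_derive_eq.
rewrite /GRing.scale /=; field; by [].
Qed.

Lemma is_derive_Phi x : is_derive x 1 (@Phi R) (phi x).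
Proof.
have int y : lebesgue_measure.-integrable `]-oo, y]%classic (EFin \o phi).
  apply: (@integrableS _ _ _ _ setT) => //; exact: integrable_normal_pdf.
have xx : x < x + 1 by rewrite ltrDl.
have [] := @continuous_FTC1 R phi -oo%O x (x + 1) xx (int _) _ _ => //.
- by rewrite ltNyr.
- exact: (@continuous_normal_pdf R 0 1 (oner_neq0 R) x).
move=> dF fE; have -> : @Phi R = fun y => (\int[lebesgue_measure]_(t in `]-oo, y]%classic) phi t)%R.
  by apply/funext.
by rewrite -fE derive1E; exact: DeriveDef.
Qed.

(** The identity, seen as a random variable under the standard normal law, makes [Phi] a cumulative
    distribution function, whose limits at both infinities are known in general. *)
Let idTR : measurableTypeR R -> R := idfun.

#[local] HB.instance Definition _ :=
  @isMeasurableFun.Build _ _ _ _ idTR (@measurable_id _ _ setT).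

Let P01 : probability (measurableTypeR R) R := normal_prob 0 1.

Lemma Phi_cdf : @Phi R = fine \o cdf (idTR : {RV P01 >-> R}).
Proof. by apply/funext => x. Qed.

Lemma Phi_cvgy : Phi x @[x --> +oo%R] --> (1 : R).
Proof.
rewrite Phi_cdf; apply: fine_cvg; exact: cvg_cdfy1.
Qed.

Lemma Phi_cvgNy : Phi x @[x --> -oo%R] --> (0 : R).
Proof.
rewrite Phi_cdf; apply: fine_cvg; exact: cvg_cdfNy0.
Qed.

Lemma Phi_ge0 x : 0 <= Phi x.
Proof. by rewrite Phi_cdf /= fine_ge0 // cdf_ge0. Qed.

Lemma Phi_incr x y : x < y -> Phi x < Phi y.
Proof.
move=> xy; rewrite -subr_gt0.
have [c _ ->] := MVT_is_derive _ _ _ _ (ltW xy) (fun t _ => is_derive_Phi t).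
by rewrite mulr_gt0 ?phi_gt0 // subr_gt0.
Qed.

Lemma Phi_le x y : x <= y -> Phi x <= Phi y.
Proof. by rewrite le_eqVlt => /orP[/eqP -> //|/Phi_incr/ltW]. Qed.

Lemma Phi_le1 x : Phi x <= 1.
Proof.
apply: (cvgr_to_ge Phi_cvgy); near=> y; apply: Phi_le.
near: y; apply: nbhs_pinfty_ge; exact: num_real.
Unshelve. all: by end_near. Qed.

(** As [phi] is even, [Phi t + Phi (- t)] has derivative zero; its constant value is read off at
    infinity. *)
Lemma PhiN x : Phi (- x) = 1 - Phi x.
Proof.
pose h t : R := Phi t + Phi (- t).
have dh (t : R) : is_derive t (1 : R) h (0 : R).
  have dN : is_derive t (1 : R) (@Phi R \o -%R) (phi (- t) * -1).
    by apply: is_derive1_comp; exact: is_derive_Phi.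
  have := is_deriveD (is_derive_Phi t) dN; rewrite phiN mulrN1 subrr.
  exact.
have hx t : h t = h x by exact: is_derive_0_is_cst.
have l1 : h t @[t --> +oo%R] --> (1 + 0 : R).
  by apply: cvgD; [exact: Phi_cvgy | exact: (proj1 (cvgNy_compNP _ _) Phi_cvgNy)].
have l2 : h t @[t --> +oo%R] --> h x.
  by rewrite (_ : h = cst (h x)); [exact: cvg_cst | apply/funext].
have : h x = 1 + 0 by apply: (cvg_unique _ l2 l1); exact: norm_hausdorff.
rewrite /h; lra.
Qed.

(** The gap [g] has derivative [phi t / t ^+ 2], so it increases; being bounded by [1 - Phi], which
    tends to 0, it is nowhere positive on the right half-line. *)
Lemma mills x : 0 < x -> x * (1 - Phi x) <= phi x.
Proof.
move=> x0; pose g t : R := 1 - Phi t - phi t / t.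
have dg (t : R) : 0 < t -> is_derive t (1 : R) g (phi t / t ^+ 2).
  move=> t0; have tn0 : t != 0 by rewrite gt_eqF.
  have dP := is_derive_Phi t; have dp := is_derive_phi t.
  have dV := is_deriveV tn0 (is_derive_id t (1 : R)).
  have d1 := is_deriveB (is_deriveB (is_derive_cst (1 : R) t 1) dP) (is_deriveM dp dV).
  apply: is_derive_eq d1 _.
  rewrite /GRing.scale /=; field; exact: tn0.
have gle y : x <= y -> g x <= 1 - Phi y.
  move=> xy.
  have [t|c /andP[xc _] e] := MVT_is_derive g (fun t => phi t / t ^+ 2) x y xy.
    by move=> /andP[xt _]; apply: dg; exact: lt_le_trans xt.
  have : 0 <= g y - g x.
    by rewrite e mulr_ge0 ?subr_ge0 // divr_ge0 ?sqr_ge0 // ltW ?phi_gt0.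
  have : 0 <= phi y / y.
    by rewrite divr_ge0 // ltW ?phi_gt0 // (lt_le_trans x0).
  rewrite /g; lra.
have P1 y : x <= y -> Phi y <= 1 - g x by move=> /gle; lra.
have : 1 <= 1 - g x.
  apply: (cvgr_to_le Phi_cvgy); near=> y; apply: P1.
  near: y; apply: nbhs_pinfty_ge; exact: num_real.
rewrite lerBrDr gerDl /g subr_le0 => h.
by rewrite mulrC -ler_pdivlMr.
Unshelve. all: by end_near. Qed.

(** Its equation [M' = x M - 1] makes this ratio, or its mirror image, up to a constant factor, the
    solution of Stein's equation on each side of the jump. *)
Definition mills_ratio x : R := (1 - Phi x) / phi x.

Lemma is_derive_mills_ratio x :
  is_derive x 1 mills_ratio (x * mills_ratio x - 1).
Proof.
have pn0 : phi x != 0 by rewrite gt_eqF ?phi_gt0.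
have dP := is_derive_Phi x; have dp := is_derive_phi x.
have dV := is_deriveV pn0 dp.
have d1 := is_deriveM (is_deriveB (is_derive_cst (1 : R) x 1) dP) dV.
apply: is_derive_eq d1 _.
rewrite /GRing.scale /= /mills_ratio !fctE; field; exact: pn0.
Qed.

Lemma mills_ratio_ge0 x : 0 <= mills_ratio x.
Proof. by rewrite divr_ge0 ?subr_ge0 ?Phi_le1 // ltW ?phi_gt0. Qed.

(** On [[-a, a]] the density is at least [phi a]; beyond [a >= 1], [mills] bounds the ratio by 1. *)
Lemma mills_ratio_le a x : 1 <= a -> - a <= x ->
  mills_ratio x <= 1 + (phi a)^-1.
Proof.
move=> a1 ax; have [xa|xa] := leP x a.
  have h : phi a <= phi x.
    by apply: phi_decr; rewrite (ger0_norm (le_trans ler01 a1)) ler_norml ax.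
  have : mills_ratio x <= (phi a)^-1.
    apply: (@le_trans _ _ (1 / phi x)).
      rewrite ler_pM2r ?invr_gt0 ?phi_gt0 // gerBl; exact: Phi_ge0.
    by rewrite div1r lef_pV2 ?posrE ?phi_gt0.
  lra.
have x1 : 1 < x by exact: le_lt_trans xa.
have : mills_ratio x <= 1.
  rewrite ler_pdivrMr ?phi_gt0 // mul1r.
  apply: le_trans (mills x _); last by rewrite (lt_trans ltr01).
  by rewrite ler_peMl ?subr_ge0 ?Phi_le1 // ltW.
by have := phi_gt0 a; rewrite -invr_gt0; lra.
Qed.

Lemma mul_mills_ratio_le1 x : x * mills_ratio x <= 1.
Proof.
have [x0|x0] := leP x 0.
  by apply: (@le_trans _ _ 0) => //; rewrite mulr_le0_ge0 ?mills_ratio_ge0.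
by rewrite mulrA ler_pdivrMr ?phi_gt0 // mul1r mills.
Qed.

(** The quantity is the derivative of [mills_ratio]. The product lies in [[0, 1]] for [x >= 0], and
    on [[-a, 0]] its size is at most [a] times the bound on the ratio. *)
Lemma mul_mills_ratio_dist a x : 1 <= a -> - a <= x ->
  `|x * mills_ratio x - 1| <= 1 + a * (1 + (phi a)^-1).
Proof.
move=> a1 ax; rewrite ler_norml.
have := mul_mills_ratio_le1 x; have := mills_ratio_le a x a1 ax.
have := mills_ratio_ge0 x; have := phi_gt0 a; rewrite -invr_gt0.
move: (mills_ratio x) ((phi a)^-1) => M q q0 M0 Mq xM.
have aq : 0 <= a * (1 + q) by rewrite mulr_ge0; lra.
apply/andP; split; last lra.
have [x0|x0] := leP 0 x.
  have : 0 <= x * M by rewrite mulr_ge0.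
  lra.
have : - (x * M) <= a * (1 + q).
  by rewrite -mulNr; apply: ler_pM; lra.
lra.
Qed.

Lemma Phi_inv_exists (e : R) : 0 < e < 1 -> exists z : R, Phi z = e.
Proof.
move=> /andP[e0 e1].
have [b be] : exists b : R, e <= Phi b.
  have : \forall t \near +oo%R, e < Phi t by apply: (cvgr_gt _ Phi_cvgy).
  by move=> /filter_ex [b /ltW]; exists b.
have [a ae] : exists a : R, Phi a <= e.
  have : \forall t \near -oo%R, Phi t < e by apply: (cvgr_lt _ Phi_cvgNy).
  by move=> /filter_ex [a /ltW]; exists a.
have ab : a <= b.
  by rewrite leNgt; apply/negP => /Phi_incr; rewrite ltNge (le_trans ae be).
have [||c _ <-] := @IVT R (@Phi R) a b e ab; last by exists c.
  apply: derivable_within_continuous => t _.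
  by have [] := is_derive_Phi t.
by rewrite ge_min ae /= le_max be orbT.
Qed.

Lemma Phi_invK (e : R) : 0 < e < 1 -> Phi (Phi_inv e) = e.
Proof.
move=> /Phi_inv_exists [z <-]; congr Phi; rewrite /Phi_inv.
have -> : [set x : R | Phi x <= Phi z]%classic = [set` `]-oo, z]].
  apply/seteqP; split => x /=; rewrite in_itv /=.
    by move=> h; rewrite leNgt; apply/negP => /Phi_incr; rewrite ltNge h.
  exact: Phi_le.
exact: sup_itv.
Qed.

End Normal.

(** * Binomial expectations *)

Section BinomialExpectation.
Context {R : realType}.
Implicit Types (p : R) (g h : nat -> R) (n : nat).

Definition bexp n p g : R :=
  \sum_(i < n.+1) 'C(n, i)%:R * (p ^+ i * (1 - p) ^+ (n - i) * g i).

Lemma eq_bexp n p g h : g =1 h -> bexp n p g = bexp n p h.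
Proof. by move=> e; apply: eq_bigr => i _; rewrite e. Qed.

Lemma bexp0 p g : bexp 0 p g = g 0.
Proof. by rewrite /bexp big_ord1 bin0 !expr0 !mul1r. Qed.

(** Pascal's rule, in the form of conditioning on one trial. *)
Lemma bexpS n p g :
  bexp n.+1 p g = p * bexp n p (g \o S) + (1 - p) * bexp n p g.
Proof.
rewrite /bexp !big_distrr /= [LHS]big_ord_recl.
under [X in _ + X = _]eq_bigr => i _ do rewrite lift0 binS natrD mulrDl.
rewrite big_split /= addrA addrC; congr (_ + _).
  by apply: eq_bigr => i _; rewrite subSS exprS /=; ring.
rewrite [in RHS]big_ord_recl big_ord_recr /= (bin_small (ltnSn n)) mul0r addr0.
congr (_ + _); first by rewrite !bin0 !subn0 [(1 - p) ^+ n.+1]exprS; ring.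
apply: eq_bigr => i _; rewrite /bump leq0n add1n subSS (_ : (n - i)%N = (n - i.+1).+1).
  by rewrite [(1 - p) ^+ (n - i.+1).+1]exprS; ring.
by have := ltn_ord i; lia.
Qed.

Lemma bexpD n p g h : bexp n p (fun i => g i + h i) = bexp n p g + bexp n p h.
Proof. by rewrite /bexp -big_split; apply: eq_bigr => i _ /=; ring. Qed.

Lemma bexpZ n p c g : bexp n p (fun i => c * g i) = c * bexp n p g.
Proof. by rewrite /bexp big_distrr; apply: eq_bigr => i _ /=; ring. Qed.

Lemma bexpB n p g h : bexp n p (fun i => g i - h i) = bexp n p g - bexp n p h.
Proof. by rewrite /bexp -sumrB; apply: eq_bigr => i _ /=; ring. Qed.

Lemma bexp_cst n p c : bexp n p (fun=> c) = c.
Proof. by elim: n => [|n IH]; rewrite ?bexp0 // bexpS /comp !IH; ring. Qed.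

Lemma bexp_ge0 n p g : 0 <= p <= 1 -> (forall i, (i <= n)%N -> 0 <= g i) ->
  0 <= bexp n p g.
Proof.
move=> /andP[p0 p1] g0; apply: sumr_ge0 => i _.
by rewrite !mulr_ge0 ?exprn_ge0 ?subr_ge0 ?g0 // -ltnS.
Qed.

Lemma le_bexp n p g h : 0 <= p <= 1 -> (forall i, g i <= h i) ->
  bexp n p g <= bexp n p h.
Proof.
move=> p01 gh; rewrite -subr_ge0 -bexpB bexp_ge0 // => i _.
by rewrite subr_ge0.
Qed.

Lemma bexp_norm n p g : 0 <= p <= 1 ->
  `|bexp n p g| <= bexp n p (fun i => `|g i|).
Proof.
move=> p01; rewrite ler_norml; apply/andP; split; last first.
  by apply: le_bexp => // i; exact: ler_norm.
rewrite -[X in _ <= X]mul1r -[X in X * _]opprK mulNr lerN2 -bexpZ.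
by apply: le_bexp => // i; rewrite mulN1r -normrN ler_norm.
Qed.

Lemma bexp_mulid n p g :
  bexp n.+1 p (fun i => i%:R * g i) = n.+1%:R * p * bexp n p (g \o S).
Proof.
elim: n g => [|n IH] g.
  by rewrite bexpS !bexp0 /=; ring.
rewrite bexpS IH.
have -> : bexp n.+1 p ((fun i => i%:R * g i) \o S) =
    bexp n.+1 p (fun i => i%:R * g i.+1) + bexp n.+1 p (g \o S).
  by rewrite -bexpD; apply: eq_bexp => i /=; rewrite -natr1; ring.
rewrite (IH (g \o S)) [bexp n.+1 p (g \o S)]bexpS.
rewrite -[n.+2%:R]natr1; ring.
Qed.

(** Size biasing ([bexp_mulid]) rewrites the part with [i], and conditioning on one trial expands
    the mean part; their difference is an increment of [g] under one trial fewer. *)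
Lemma bexp_stein n p g :
  bexp n.+1 p (fun i => (i%:R - n.+1%:R * p) * g i) =
  n.+1%:R * p * (1 - p) * bexp n p (fun i => g i.+1 - g i).
Proof.
have -> : bexp n.+1 p (fun i => (i%:R - n.+1%:R * p) * g i) =
    bexp n.+1 p (fun i => i%:R * g i) - n.+1%:R * p * bexp n.+1 p g.
  by rewrite -bexpZ -bexpB; apply: eq_bexp => i; ring.
rewrite bexp_mulid bexpS bexpB /comp; ring.
Qed.

Lemma bexp_var n p :
  bexp n p (fun i => (i%:R - n%:R * p) ^+ 2) = n%:R * p * (1 - p).
Proof.
case: n => [|n]; first by rewrite bexp0; ring.
under eq_bexp => i do rewrite expr2.
rewrite bexp_stein.
under eq_bexp => i.
  rewrite (_ : i.+1%:R - n.+1%:R * p - (i%:R - n.+1%:R * p) = 1); last first.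
    by rewrite -(natr1 i); ring.
  over.
by rewrite bexp_cst mulr1.
Qed.

Lemma bexp_absdev n p s : 0 <= p <= 1 -> 0 < s -> s ^+ 2 = n%:R * p * (1 - p) ->
  bexp n p (fun i => `|i%:R - n%:R * p|) <= s.
Proof.
move=> p01 s0 s2.
(* A pointwise AM-GM inequality replaces Cauchy-Schwarz; with [s ^+ 2] equal to the variance, its
   expectation is exactly [s]. *)
have amgm (x : R) : `|x| <= (2 * s)^-1 * (x ^+ 2 + s ^+ 2).
  rewrite ler_pdivlMl ?mulr_gt0 // -(real_normK (num_real x)).
  have := sqr_ge0 (`|x| - s); nra.
apply: le_trans (le_bexp _ _ _ _ p01 (fun i => amgm (i%:R - n%:R * p))) _.
rewrite bexpZ bexpD bexp_var bexp_cst -s2.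
rewrite le_eqVlt; apply/orP; left; apply/eqP; field; exact/lt0r_neq0.
Qed.

(** For [g] the indicator of [k < i], the increments in [bexp_stein] are the indicator of [k], while
    the left side is at most the mean absolute deviation, hence at most [s]. Dividing by [s ^+ 2]
    gives the bound. *)
Lemma bexp_pred1 n p s k : 0 <= p <= 1 -> 0 < s ->
  s ^+ 2 = n.+1%:R * p * (1 - p) ->
  bexp n p (fun i => (i == k)%:R) <= s^-1.
Proof.
move=> p01 s0 s2.
have e := bexp_stein n p (fun i => (k < i)%:R).
have e2 : bexp n p (fun i => (k < i.+1)%:R - (k < i)%:R) =
    bexp n p (fun i => (i == k)%:R).
  apply: eq_bexp => i; rewrite ltnS eq_sym.
  by case: (ltngtP k i) => _; rewrite ?subrr ?subr0.
rewrite e2 -s2 in e.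
have : s ^+ 2 * bexp n p (fun i => (i == k)%:R) <= s.
  rewrite -e; apply: le_trans (bexp_absdev n.+1 p s p01 s0 s2).
  apply: le_bexp => // i; case: (k < i)%N; rewrite ?mulr1 ?mulr0 ?normr_ge0 //.
  exact: ler_norm.
rewrite expr2 -mulrA ger_pMr // => h.
by rewrite -[s^-1]mulr1 ler_pdivlMl.
Qed.

End BinomialExpectation.

(** * Normal approximation by Stein's method *)

Section Stein.
Context {R : realType}.

(* Solution of Stein's equation f' x - x f x = 1{x <= y} - Phi y. *)
Definition stein_sol (y x : R) : R :=
  if x <= y then (1 - Phi y) * mills_ratio (- x) else Phi y * mills_ratio x.

(** The two branches agree at [x = y] by the symmetry of the normal law, so each formula holds up to
    and including the kink. *)
Lemma stein_solr (y x : R) : y <= x -> stein_sol y x = Phi y * mills_ratio x.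
Proof.
rewrite /stein_sol le_eqVlt => /orP[/eqP <-|yx]; last by rewrite leNgt yx.
by rewrite lexx /mills_ratio phiN PhiN; ring.
Qed.

Lemma stein_soll (y x : R) : x <= y ->
  stein_sol y x = (1 - Phi y) * mills_ratio (- x).
Proof. by rewrite /stein_sol => ->. Qed.

(** Away from the kink the solution is smooth with derivative bounded by [B]. The mean value theorem
    yields the first-order bound, and used a second time, between [x] and the intermediate point,
    the second-order one. *)
Lemma stein_step (A : R) : 1 <= A -> exists2 B : R, 0 <= B &
  forall y : R, `|y| <= A -> (forall x : R, `|stein_sol y x| <= B) /\
  forall x h : R, 0 <= h -> (x + h <= y) || (y <= x) ->
    `|stein_sol y (x + h) - stein_sol y x| <= B * h /\
    `|stein_sol y (x + h) - stein_sol y x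
      - (x * stein_sol y x + (x + h <= y)%R%:R - Phi y) * h|
      <= (`|x| + 1) * B * h ^+ 2.
Proof.
move=> A1; pose q := 1 + (phi A)^-1; pose B := 1 + A * q.
have q1 : 1 < q by rewrite /q ltrDl invr_gt0 phi_gt0.
have qB : q <= B.
  have : q <= A * q by rewrite ler_peMl //; lra.
  rewrite /B; lra.
have B0 : 0 <= B by lra.
exists B => // y; rewrite ler_norml => /andP[Ay yA].
have P0 := Phi_ge0 y; have P1 := Phi_le1 y.
have bd x : `|stein_sol y x| <= B.
  rewrite /stein_sol; case: (leP x y) => xy.
    have := mills_ratio_ge0 (- x); have := @mills_ratio_le R A (- x) A1.
    rewrite lerN2 (le_trans xy yA) => /(_ isT) => h1 h0.
    have P2 : 0 <= 1 - Phi y by lra.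
    rewrite ger0_norm; last exact: mulr_ge0.
    apply: le_trans qB; rewrite -[X in _ <= X]mul1r; apply: ler_pM => //.
    by rewrite gerBl.
  have := mills_ratio_ge0 x; have := @mills_ratio_le R A x A1.
  rewrite (le_trans Ay (ltW xy)) => /(_ isT) => h1 h0.
  rewrite ger0_norm; last exact: mulr_ge0.
  by apply: le_trans qB; rewrite -[X in _ <= X]mul1r; apply: ler_pM.
have step (x h : R) : 0 <= h -> (x + h <= y) || (y <= x) ->
    exists2 c, x <= c <= x + h &
      stein_sol y (x + h) - stein_sol y x
        = (c * stein_sol y c + (x + h <= y)%R%:R - Phi y) * h
      /\ `|c * stein_sol y c + (x + h <= y)%R%:R - Phi y| <= B.
  move=> h0 side; have xxh : x <= x + h by rewrite lerDl.
  case: (leP (x + h) y) side => [xy _|xy /= yx].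
    have [t _|c cxh e] := @MVT_is_derive R (fun t => (1 - Phi y) * mills_ratio (- t))
      (fun t => (1 - Phi y) * ((- t * mills_ratio (- t) - 1) * -1)) x (x + h) xxh.
      have dN : is_derive t (1 : R) (@mills_ratio R \o -%R)
          ((- t * mills_ratio (- t) - 1) * -1).
        by apply: is_derive1_comp; exact: is_derive_mills_ratio.
      exact: is_deriveZ dN.
    exists c => //; have /andP[xc ch] := cxh; have cy := le_trans ch xy.
    rewrite !stein_soll // ?(le_trans xxh) // e (_ : x + h - x = h); last by ring.
    have -> : c * ((1 - Phi y) * mills_ratio (- c)) + true%:R - Phi y =
      (1 - Phi y) * ((- c * mills_ratio (- c) - 1) * -1) by rewrite /=; ring.
    split=> //; rewrite normrM ger0_norm ?subr_ge0 // mulrN1 normrN.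
    have := @mul_mills_ratio_dist R A (- c) A1.
    rewrite lerN2 (le_trans cy yA) => /(_ isT) hB.
    rewrite -[X in _ <= X]mul1r; apply: ler_pM => //; last by rewrite gerBl.
    by rewrite subr_ge0.
  have [t _|c cxh e] := @MVT_is_derive R (fun t => Phi y * mills_ratio t)
      (fun t => Phi y * (t * mills_ratio t - 1)) x (x + h) xxh.
    exact: (is_deriveZ _ (is_derive_mills_ratio t)).
  exists c => //; have /andP[xc ch] := cxh; have yc := le_trans yx xc.
  rewrite !stein_solr // ?(le_trans yx) // e (_ : x + h - x = h); last by ring.
  have -> : c * (Phi y * mills_ratio c) + false%:R - Phi y =
      Phi y * (c * mills_ratio c - 1) by rewrite /=; ring.
  split=> //; rewrite normrM ger0_norm //.
  have := @mul_mills_ratio_dist R A c A1.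
  rewrite (le_trans Ay yc) => /(_ isT) hB.
  by rewrite -[X in _ <= X]mul1r; apply: ler_pM.
split=> // x h h0 side.
have [c /andP[xc ch] [e eB]] := step x h h0 side.
split; first by rewrite e normrM [`|h|]ger0_norm // ler_wpM2r.
have side' : (x + (c - x) <= y) || (y <= x).
  rewrite addrC subrK; case/orP: side => [xy|->]; last by rewrite orbT.
  by rewrite (le_trans ch).
have cx0 : 0 <= c - x by rewrite subr_ge0.
have [c' _ [e' e'B]] := step x (c - x) cx0 side'.
have fc : `|stein_sol y c - stein_sol y x| <= B * (c - x).
  move: e'; rewrite [x + _]addrC subrK => ->.
  rewrite normrM [`|c - x|]ger0_norm ?subr_ge0 // ler_wpM2r ?subr_ge0 //.
  by move: e'B; rewrite [x + _]addrC subrK.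
(* By Stein's equation, the derivatives at [c] and at [x] differ by this combination; the constant
   and the indicator cancel. *)
have -> : stein_sol y (x + h) - stein_sol y x
      - (x * stein_sol y x + (x + h <= y)%R%:R - Phi y) * h =
   (x * (stein_sol y c - stein_sol y x) + (c - x) * stein_sol y c) * h.
  by rewrite e; ring.
rewrite normrM [`|h|]ger0_norm // expr2 mulrA ler_wpM2r //.
apply: le_trans (ler_normD _ _) _; rewrite !normrM [`|c - x|]ger0_norm ?subr_ge0 //.
have h1 : `|x| * `|stein_sol y c - stein_sol y x| <= `|x| * (B * h).
  by apply: ler_wpM2l => //; apply: le_trans fc _; apply: ler_wpM2l => //; lra.
have h2 : (c - x) * `|stein_sol y c| <= h * B by apply: ler_pM => //; lra.
lra.
Qed.

Lemma binomial_clt (p A : R) : 0 < p < 1 -> exists2 K : R, 0 <= K &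
  forall (n k : nat) (s : R), 0 < s -> s ^+ 2 = n.+1%:R * p * (1 - p) ->
    let y := (k%:R - n.+1%:R * p) / s in `|y| <= A ->
    `|bexp n p (fun i => (i < k)%N%:R) - Phi y| <= K / s.
Proof.
move=> /andP[p0 p1].
have [] := stein_step (Num.max 1 A); first by rewrite le_max lexx.
move=> B B0 HB.
have p01 : 0 <= p <= 1 by rewrite !ltW.
pose d := p * (1 - p).
have d0 : 0 < d by rewrite mulr_gt0 // subr_gt0.
(* The pointwise error will be [2 * B * h * (|a| + 1)] with [h = 1 / s]; the mean of [|a|] is at
   most [1 + h], and [h] is at most [1 / sqrt d]. *)
exists (2 * B * (2 + (Num.sqrt d)^-1)).
  by rewrite !mulr_ge0 // addr_ge0 // invr_ge0 sqrtr_ge0.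
move=> n k s s0 s2 y yA; pose f := stein_sol y; pose h := s^-1.
have h0 : 0 < h by rewrite invr_gt0.
have [|fB fstep] := HB y; first by rewrite le_max yA orbT.
pose a (i : nat) := (i%:R - n.+1%:R * p) * h.
have aS i : a i.+1 = a i + h by rewrite /a -natr1; ring.
(* Since [y] is the normalization of the integer [k], no step from [a i] to [a i + h] crosses the
   kink. *)
have side i : (a i + h <= y) = (i < k)%N.
  by rewrite -aS /a /y ler_pM2r // lerD2r ler_nat.
have side' i : (a i + h <= y) || (y <= a i).
  rewrite side; case: ltnP => //= ki.
  by rewrite /a /y ler_pM2r // lerD2r ler_nat.
(* One expectation over [n.+1] trials is evaluated twice, by the Stein identity here and by
   conditioning on one trial in [E2]; the difference can be added for free. *)
have E1 : bexp n.+1 p (fun i => a i * f (a i)) =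
    bexp n p (fun i => (f (a i + h) - f (a i)) * s).
  have -> : bexp n.+1 p (fun i => a i * f (a i)) =
      h * bexp n.+1 p (fun i => (i%:R - n.+1%:R * p) * f (a i)).
    by rewrite -bexpZ; apply: eq_bexp => i; rewrite {1}/a; ring.
  rewrite (bexp_stein n p (fun i => f (a i))) -s2.
  rewrite mulrA (_ : h * s ^+ 2 = s); last by rewrite /h expr2 mulKf ?lt0r_neq0.
  by rewrite -bexpZ; apply: eq_bexp => i; rewrite aS mulrC.
have E2 : bexp n.+1 p (fun i => a i * f (a i)) =
    bexp n p (fun i => p * ((a i + h) * f (a i + h)) + (1 - p) * (a i * f (a i))).
  by rewrite bexpS bexpD !bexpZ; congr (_ * _ + _); apply: eq_bexp => i /=; rewrite aS.
have -> : bexp n p (fun i => (i < k)%N%:R) - Phi y =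
   bexp n p (fun i => ((i < k)%N%:R - Phi y) + (p * ((a i + h) * f (a i + h)) + (1 - p) * (a i * f (a i)))
    - (f (a i + h) - f (a i)) * s).
  by rewrite bexpB bexpD bexpB bexp_cst -E1 -E2; ring.
apply: le_trans (bexp_norm _ _ _ p01) _.
have pt i : `|((i < k)%N%:R - Phi y) + (p * ((a i + h) * f (a i + h)) + (1 - p) * (a i * f (a i)))
    - (f (a i + h) - f (a i)) * s| <= 2 * B * h * (`|a i| + 1).
  have [st1 st2] := fstep (a i) h (ltW h0) (side' i).
  rewrite side -/f in st1 st2.
  (* As [s * h = 1], Stein's equation cancels the leading terms. What is left, a second-order
     remainder times [s] and [p] times a first-order increment, is of order [h]. *)
  have -> : ((i < k)%N%:R - Phi y) + (p * ((a i + h) * f (a i + h)) + (1 - p) * (a i * f (a i)))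
    - (f (a i + h) - f (a i)) * s =
    - ((f (a i + h) - f (a i) - (a i * f (a i) + (i < k)%N%:R - Phi y) * h) * s)
    + p * (a i * (f (a i + h) - f (a i)) + h * f (a i + h)).
    rewrite /h; field; exact: lt0r_neq0.
  apply: le_trans (ler_normD _ _) _.
  rewrite normrN normrM [`|s|]gtr0_norm // [`|p * _|]normrM [`|p|]gtr0_norm //.
  have h1 : `|f (a i + h) - f (a i) - (a i * f (a i) + (i < k)%N%:R - Phi y) * h| * s
     <= (`|a i| + 1) * B * h.
    rewrite -ler_pdivlMr // -/h; apply: le_trans st2 _.
    by rewrite le_eqVlt expr2 mulrA eqxx.
  have h2 : p * `|a i * (f (a i + h) - f (a i)) + h * f (a i + h)| <=
     (`|a i| + 1) * B * h.
    rewrite -[X in _ <= X]mul1r; apply: ler_pM => //; try lra.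
    apply: le_trans (ler_normD _ _) _.
    rewrite [`|a i * _|]normrM [`|h * _|]normrM [`|h|]gtr0_norm //.
    have := fB (a i + h); rewrite -/f => fb.
    have : `|a i| * `|f (a i + h) - f (a i)| <= `|a i| * (B * h) by apply: ler_wpM2l.
    have : h * `|f (a i + h)| <= h * B by apply: ler_wpM2l => //; exact: ltW.
    lra.
  lra.
apply: le_trans (le_bexp _ _ _ _ p01 pt) _.
rewrite bexpZ bexpD bexp_cst.
have sd : Num.sqrt d <= s.
  rewrite -(ger0_norm (ltW s0)) -sqrtr_sqr ler_wsqrtr // s2 -mulrA.
  by rewrite ler_peMl ?(ltW d0) // ler1n.
have ea : bexp n p (fun i => `|a i|) <= 1 + h.
  have le1 i : `|a i| <= h * (`|i%:R - n%:R * p| + p).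
    rewrite /a normrM [`|h|]gtr0_norm // mulrC; apply: ler_wpM2l; first exact: ltW.
    rewrite (_ : _ - _ = (i%:R - n%:R * p) - p); last by rewrite -natr1; ring.
    by apply: le_trans (ler_normB _ _) _; rewrite [`|p|]gtr0_norm.
  apply: le_trans (le_bexp _ _ _ _ p01 le1) _.
  rewrite bexpZ bexpD bexp_cst.
  have : bexp n p (fun i => `|i%:R - n%:R * p|) <= s.
    apply: (le_trans (y := Num.sqrt (n%:R * p * (1 - p)))); last first.
      rewrite -(ger0_norm (ltW s0)) -sqrtr_sqr ler_wsqrtr // s2 -!mulrA.
      by rewrite ler_wpM2r ?(ltW d0) // ler_nat.
    case: n {s2 y yA f fB fstep a aS side side' E1 E2 pt le1} => [|n].
      by rewrite bexp0 !mul0r subrr normr0 sqrtr_ge0.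
    apply: bexp_absdev => //; last first.
      by rewrite sqr_sqrtr // -mulrA mulr_ge0 // ltW.
    by rewrite sqrtr_gt0 -mulrA mulr_gt0 // ltr0n.
  move=> hs; have : h * (bexp n p (fun i => `|i%:R - n%:R * p|) + p) <= h * (s + 1).
    apply: ler_wpM2l; first exact: ltW.
    by apply: lerD => //; exact: ltW.
  by move=> /le_trans; apply; rewrite mulrDr mulr1 mulVf // lt0r_neq0.
have hd : h <= (Num.sqrt d)^-1 by rewrite lef_pV2 ?posrE // sqrtr_gt0.
rewrite -/h -!mulrA; do 2 apply: ler_wpM2l => //.
rewrite mulrC; apply: ler_wpM2r; first exact: ltW.
lra.
Qed.

End Stein.

(** * Closed forms of the two bounds *)

Section ExactFormulas.
Context {R : realType}.

Lemma sum_gt_indicator (M N : nat) :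
  \sum_(1 <= j < N.+1) (M < j)%N%:R = (N - M)%N%:R :> R.
Proof.
elim: N => [|N IH]; first by rewrite big_geq.
rewrite big_nat_recr //= IH ltnS; case: leqP => h.
  by rewrite subSn // natr1.
by rewrite addr0; congr _%:R; lia.
Qed.

Lemma sum_le_pred (M N : nat) :
  \sum_(1 <= j < N.+1) (j <= M)%N%:R * (j%:R - 1)
    = (minn N M)%:R * ((minn N M)%:R - 1) / 2 :> R.
Proof.
elim: N => [|N IH]; first by rewrite big_geq // min0n !mul0r.
rewrite big_nat_recr //= IH; case: (leqP N.+1 M) => h.
  rewrite (minn_idPl (ltnW h)) -natr1 /=; field; by [].
by rewrite mul0r addr0 (minn_idPr _).
Qed.

(** Origin of the floor of [m/2] in the closed forms: the candidates outnumber the syndromes exactly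
    when [w] exceeds it. *)
Lemma pow4_le2 (w m : nat) : (4 ^ w <= 2 ^ m)%N = (w <= m./2)%N.
Proof.
by rewrite (_ : 4 = 2 ^ 2)%N // -expnM leq_exp2l //; lia.
Qed.

Lemma eps_convE (n m : nat) (delta : R) rk : 0 <= delta <= 1 ->
  rank_order (pUV_erasure n delta) rk ->
  eps_conv m (pUV_erasure n delta) rk =
  bexp n delta (fun w => (m./2 < w)%N%:R * (1 - 2 ^+ m / 4 ^+ w)).
Proof.
move=> d01 hrk; rewrite /bexp.
rewrite -(sum_wt _ n (fun w => delta ^+ w * (1 - delta) ^+ (n - w)
  * ((m./2 < w)%N%:R * (1 - 2 ^+ m / 4 ^+ w)))).
apply: eq_bigr => v _.
transitivity (\sum_u pUV_erasure n delta u v * (2 ^ m < rk v u)%N%:R).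
  by apply: eq_bigr => u _; case: ifP; rewrite ?mulr1 ?mulr0.
rewrite (sum_rank R n delta rk v (fun j => (2 ^ m < j)%N%:R)) //.
rewrite sum_gt_indicator -mulrA; congr (_ * _).
have w0 : (4 : R) ^+ wt v != 0 by rewrite expf_neq0.
rewrite ltnNge -pow4_le2 -ltnNge; case: ltnP => h.
  by rewrite natrB ?(ltnW h) // !natrX /=; field.
by rewrite mul0r (eqP h) mulr0.
Qed.

(** With [M] the minimum of [4 ^ w] and [2 ^ m], the ranks up to [2 ^ m] contribute [M (M - 1) / 2];
    the two branches are the two values of the minimum. *)
Lemma eps_achE (n m : nat) (delta : R) rk : 0 <= delta <= 1 ->
  rank_order (pUV_erasure n delta) rk ->
  eps_ach m (pUV_erasure n delta) rk =
  bexp n delta (fun w => if (m./2 < w)%N then 1 - (2 ^+ m + 1) / 2 / 4 ^+ w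
    else (4 ^+ w - 1) / 2 ^+ m.+1).
Proof.
move=> d01 hrk; rewrite /eps_ach (eps_convE _ _ _ _ d01 hrk).
have -> : \sum_(v : vecF n) \sum_(u : vecF n.*2)
     (if (rk v u <= 2 ^ m)%N then pUV_erasure n delta u v * ((rk v u)%:R - 1)
       / (2 ^ m)%:R else 0) =
  bexp n delta (fun w => (minn (4 ^ w) (2 ^ m))%:R
    * ((minn (4 ^ w) (2 ^ m))%:R - 1) / 2 / 2 ^+ m / 4 ^+ w).
  rewrite /bexp.
  rewrite -(sum_wt _ n (fun w => delta ^+ w * (1 - delta) ^+ (n - w) *
   ((minn (4 ^ w) (2 ^ m))%:R * ((minn (4 ^ w) (2 ^ m))%:R - 1) / 2 / 2 ^+ m / 4 ^+ w))).
  apply: eq_bigr => v _.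
  transitivity ((\sum_u pUV_erasure n delta u v *
     ((rk v u <= 2 ^ m)%N%:R * ((rk v u)%:R - 1))) / 2 ^+ m).
    rewrite big_distrl; apply: eq_bigr => u _ /=.
    by rewrite natrX; case: ifP; rewrite ?mul1r ?mul0r ?mulr0 ?mul0r.
  rewrite (sum_rank R n delta rk v (fun j => (j <= 2 ^ m)%N%:R * (j%:R - 1))) //.
  by rewrite sum_le_pred; ring.
rewrite -bexpD; apply: eq_bexp => w.
have w0 : (4 : R) ^+ w != 0 by rewrite expf_neq0.
have m0 : (2 : R) ^+ m != 0 by rewrite expf_neq0.
rewrite ltnNge -pow4_le2 -ltnNge; case: ltnP => h.
  rewrite !natrX /=; field; exact/andP.
rewrite !natrX /= [2 ^+ m.+1]exprS; field; exact/andP.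
Qed.

(* The paper's upper tails are written as lower tails of the reflected law n - |V|. *)
Lemma bexp_tail (n t : nat) (p a : R) : 1 - p + p * a != 0 ->
  bexp n p (fun w => (t < w)%N%:R * a ^+ w) =
  (1 - p + p * a) ^+ n * Bcdf n ((1 - p) / (1 - p + p * a)) (n%:Z - t%:Z - 1).
Proof.
move=> c0; set c := 1 - p + p * a.
(* Exponential tilting: the factor [a ^+ i] turns the binomial law into another one with normalizer
   [c], read here after exchanging successes and failures. *)
have term (i : nat) : (i <= n)%N ->
   'C(n, i)%:R * (p ^+ i * (1 - p) ^+ (n - i) * a ^+ i) =
   c ^+ n * ('C(n, n - i)%:R * ((1 - p) / c) ^+ (n - i) * (1 - (1 - p) / c) ^+ (n - (n - i))).
  move=> hi; rewrite bin_sub // subKn //.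
  have -> : 1 - (1 - p) / c = p * a / c by rewrite /c; field.
  rewrite (_ : c ^+ n = c ^+ (n - i) * c ^+ i); last by rewrite -exprD subnK.
  rewrite !expr_div_n !exprMn.
  by field; rewrite !expf_neq0.
(* For [t >= n] the tail is empty and the index is negative, where [Bcdf] is 0. *)
case: (ltnP t n) => tn; last first.
  have -> : (n%:Z - t%:Z - 1)%R = Negz (t - n) by lia.
  rewrite /= mulr0 /bexp big1 // => i _.
  by rewrite (_ : (t < i)%N = false) ?mul0r ?mulr0 //; have := ltn_ord i; lia.
have -> : (n%:Z - t%:Z - 1)%R = Posz (n - t.+1) by lia.
rewrite /= big_distrr /bexp.
pose G i : R := c ^+ n * ('C(n, i)%:R * ((1 - p) / c) ^+ i * (1 - (1 - p) / c) ^+ (n - i)).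
rewrite -(big_mkord xpredT (fun i => G i)).
rewrite -(big_mkord xpredT (fun i => 'C(n, i)%:R * (p ^+ i * (1 - p) ^+ (n - i) * ((t < i)%N%:R * a ^+ i)))).
rewrite (@big_cat_nat _ _ _ t.+1) //=; last by lia.
rewrite big_nat big1 ?add0r; last first.
  by move=> i /andP[_ it]; rewrite ltnNge -ltnS it /= mul0r !mulr0.
rewrite [RHS]big_nat_rev /= add0n.
rewrite (_ : (n - t.+1).+1 = n.+1 - t.+1)%N; last by lia.
rewrite -{1}[t.+1]add0n big_addn.
apply: eq_big_nat => i /andP[_ hi].
rewrite (_ : (t < i + t.+1)%N); last by lia.
rewrite mul1r term; last by lia.
rewrite /G (_ : (n.+1 - t.+1 - i.+1)%N = (n - (i + t.+1))%N) //; lia.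
Qed.

Lemma bexp_head (n t : nat) (p a : R) : 1 - p + p * a != 0 ->
  (t <= n)%N ->
  bexp n p (fun w => (w <= t)%N%:R * a ^+ w) =
  (1 - p + p * a) ^+ n * Bcdf n (p * a / (1 - p + p * a)) t%:Z.
Proof.
move=> c0 tn; set c := 1 - p + p * a.
rewrite /= big_distrr /bexp /=.
pose G i : R := 'C(n, i)%:R * (p ^+ i * (1 - p) ^+ (n - i) * ((i <= t)%N%:R * a ^+ i)).
rewrite -(big_mkord xpredT G) (@big_cat_nat _ _ _ t.+1) //=.
rewrite [X in _ + X]big_nat [X in _ + X]big1 ?addr0; last first.
  by move=> i /andP[ti _]; rewrite /G leqNgt ti /= mul0r !mulr0.
rewrite big_mkord; apply: eq_bigr => i _.
have it : (i <= t)%N by rewrite -ltnS.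
rewrite /G it mul1r (_ : 1 - p * a / c = (1 - p) / c); last first.
  by rewrite /c; field.
have hi := leq_trans it tn.
rewrite (_ : c ^+ n = c ^+ (n - i) * c ^+ i); last by rewrite -exprD subnK.
rewrite !expr_div_n !exprMn.
by field; rewrite !expf_neq0.
Qed.

End ExactFormulas.

Lemma erasure_eps_formulas (R : realType) (delta : R) (n m : nat) rk :
  0 <= delta <= 1 -> (m <= n)%N -> rank_order (pUV_erasure n delta) rk ->
  let i0 : int := (n%:Z - (m./2)%:Z - 1)%R in
    eps_conv m (pUV_erasure n delta) rk =
       Bcdf n (1 - delta) i0
       - (2 ^ m)%N%:R * ((4 - 3 * delta) / 4) ^+ n
         * Bcdf n ((4 - 4 * delta) / (4 - 3 * delta)) i0
     /\
     eps_ach m (pUV_erasure n delta) rk =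
       (1 + ((2 ^ m.+1)%N%:R)^-1) * Bcdf n (1 - delta) i0
       - ((2 ^ m.+1)%N%:R)^-1
       - ((2 ^ m)%N%:R + 1) / 2 * ((4 - 3 * delta) / 4) ^+ n
         * Bcdf n ((4 - 4 * delta) / (4 - 3 * delta)) i0
       + (1 + 3 * delta) ^+ n / (2 ^ m.+1)%N%:R
         * Bcdf n (4 * delta / (1 + 3 * delta)) (m./2)%:Z.
Proof.
move=> /andP[d0 d1] mn hrk i0; have d01 : 0 <= delta <= 1 by rewrite d0.
pose t := m./2.
(* [T1], [T2], [T3] are the tilts by [a = 1], [1/4] and [4], with normalizers [1],
   [(4 - 3 * delta) / 4] and [1 + 3 * delta]. *)
have T1 : bexp n delta (fun w => (t < w)%N%:R) = Bcdf n (1 - delta) i0.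
  have := @bexp_tail R n t delta 1.
  rewrite mulr1 subrK expr1n mul1r divr1 => <-; last exact: oner_neq0.
  by apply: eq_bexp => w; rewrite expr1n mulr1.
have T2 : bexp n delta (fun w => (t < w)%N%:R / 4 ^+ w) =
   ((4 - 3 * delta) / 4) ^+ n * Bcdf n ((4 - 4 * delta) / (4 - 3 * delta)) i0.
  have c0 : 4 - 3 * delta != 0 by rewrite gt_eqF //; lra.
  have := @bexp_tail R n t delta 4^-1.
  have -> : 1 - delta + delta / 4 = (4 - 3 * delta) / 4 by field.
  have -> : (1 - delta) / ((4 - 3 * delta) / 4) = (4 - 4 * delta) / (4 - 3 * delta).
    by field.
  move=> <-; last by rewrite mulf_neq0 // invr_eq0.
  by apply: eq_bexp => w; rewrite exprVn.
have T3 : bexp n delta (fun w => (w <= t)%N%:R * 4 ^+ w) =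
   (1 + 3 * delta) ^+ n * Bcdf n (4 * delta / (1 + 3 * delta)) t%:Z.
  have c0 : 1 + 3 * delta != 0 by rewrite gt_eqF //; lra.
  have := @bexp_head R n t delta 4.
  have -> : 1 - delta + delta * 4 = 1 + 3 * delta by ring.
  by rewrite [delta * 4]mulrC => <- //; rewrite /t; lia.
rewrite (eps_convE _ _ _ _ d01 hrk) (eps_achE _ _ _ _ d01 hrk) !natrX; split.
  rewrite -mulrA -T1 -T2 -bexpZ -bexpB; apply: eq_bexp => w.
  by rewrite -/t; ring.
pose q : R := (2 ^+ m.+1)^-1.
(* The term [- q] on the event [w <= t] is written as [- q + q * (t < w)], whence the isolated [- q]
   and the factor [1 + q]. *)
transitivity (bexp n delta (fun w => (1 + q) * (t < w)%N%:R - q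
   - (2 ^+ m + 1) / 2 * ((t < w)%N%:R / 4 ^+ w) + q * ((w <= t)%N%:R * 4 ^+ w))).
  by apply: eq_bexp => w; rewrite -/t [(w <= t)%N]leqNgt /q; case: ltnP => _ /=; ring.
rewrite bexpD !bexpB !bexpZ bexp_cst T1 T2 T3 /q /t /i0.
move: (Bcdf _ _ _) (Bcdf _ _ _) (Bcdf _ _ _) (((4 - 3 * delta) / 4) ^+ n).
move: ((1 + 3 * delta) ^+ n) ((2 ^+ m.+1)^-1) => a b c d e f. ring.
Qed.

(** * Symplectic matrices over F_2 *)

Lemma F2_addxx (x : F) : x + x = 0.
Proof. by case: x => -[|[|//]] h; exact/val_inj. Qed.

Lemma F2_neq0 (x : F) : (x != 0) = (x == 1).
Proof. by case: x => -[|[|//]] h. Qed.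

Lemma vecF_addxx (m N : nat) (u : 'M[F]_(m, N)) : u + u = 0.
Proof. by apply/matrixP => i j; rewrite !mxE F2_addxx. Qed.

Section Symplectic.
Variable n : nat.
Local Notation vec := (vecF n.*2).
Local Notation Rn := (Rmat n).

Lemma RmatT : Rn^T = Rn.
Proof.
apply/matrixP => i j; rewrite !mxE; congr (_%:R); congr nat_of_bool.
by apply/eqP/eqP => ->; rewrite rev_ordK.
Qed.

Lemma Rmat_mulE (u : vec) i : (Rn *m u) i 0 = u (rev_ord i) 0.
Proof.
rewrite mxE (bigD1 (rev_ord i)) //= mxE eqxx mul1r big1 ?addr0 // => j jn.
by rewrite mxE (negbTE jn) mul0r.
Qed.

Lemma Rmat_sqr : Rn *m Rn = 1%:M.
Proof.
apply/matrixP => i j; rewrite mxE (bigD1 (rev_ord i)) //= !mxE eqxx mul1r.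
rewrite big1 ?addr0 => [|k kn]; last by rewrite mxE (negbTE kn) mul0r.
by rewrite rev_ordK eq_sym.
Qed.

Definition sform (u v : vec) : F := (u^T *m Rn *m v) 0 0.

Lemma sform_mxE (u v : vec) : u^T *m Rn *m v = (sform u v)%:M.
Proof. exact: mx11_scalar. Qed.

Lemma sformC (u v : vec) : sform u v = sform v u.
Proof.
rewrite /sform -[in RHS](trmxK (v^T *m Rn *m u)) [in RHS]mxE.
by rewrite !trmx_mul trmxK RmatT mulmxA.
Qed.

Lemma sformDl (u v w : vec) : sform (u + v) w = sform u w + sform v w.
Proof. by rewrite /sform linearD /= !mulmxDl mxE. Qed.

Lemma sformDr (u v w : vec) : sform w (u + v) = sform w u + sform w v.
Proof. by rewrite /sform mulmxDr mxE. Qed.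

Lemma sformE (u v : vec) : sform u v = \sum_i u i 0 * v (rev_ord i) 0.
Proof.
rewrite /sform -mulmxA mxE; apply: eq_bigr => i _.
by rewrite mxE Rmat_mulE.
Qed.

(** Mirror coordinates give equal products, so each product occurs twice and cancels in
    characteristic two. *)
Lemma sform_alt (u : vec) : sform u u = 0.
Proof.
rewrite sformE (bigID (fun i : 'I_(n.*2) => (i < n)%N)) /=.
rewrite [X in _ + X](reindex_inj rev_ord_inj) /=.
have -> : \sum_(i < n.*2 | ~~ (n.*2 - i.+1 < n)%N)
      u (rev_ord i) 0 * u (rev_ord (rev_ord i)) 0 =
   \sum_(i < n.*2 | (i < n)%N) u i 0 * u (rev_ord i) 0.
  apply: eq_big => [i|i _]; first by have := ltn_ord i; lia.
  by rewrite rev_ordK mulrC.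
exact: F2_addxx.
Qed.

Lemma sform_nondeg (u : vec) : u != 0 -> exists v, sform u v = 1.
Proof.
move=> u0; have [i ui] : exists i, u i 0 != 0.
  apply/existsP; apply: contraNT u0; rewrite negb_exists => /forallP h.
  apply/eqP/matrixP => i j; rewrite [j]ord1 mxE.
  by have := h i; rewrite negbK => /eqP.
exists (\col_j (j == rev_ord i)%:R).
rewrite sformE (bigD1 i) //= mxE eqxx mulr1 big1 ?addr0.
  by apply/eqP; rewrite -F2_neq0.
by move=> j ji; rewrite mxE (inj_eq rev_ord_inj) (negbTE ji) mulr0.
Qed.

Definition transvection (a : vec) : 'M[F]_(n.*2) := 1%:M + a *m (a^T *m Rn).

Lemma transvectionE (a x : vec) : transvection a *m x = x + sform a x *: a.
Proof.
by rewrite /transvection mulmxDl mul1mx -mulmxA sform_mxE mul_mx_scalar.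
Qed.

Lemma transvection_symplectic (a : vec) : symplectic (transvection a).
Proof.
apply/eqP; rewrite /transvection [(1%:M + _)^T]linearD /= trmx1 !trmx_mul trmxK RmatT.
rewrite mulmxDr mulmx1 !mulmxDl !mul1mx -!mulmxA.
have -> : a^T *m (Rn *m (a *m (a^T *m Rn))) = 0.
  rewrite !mulmxA sform_mxE sform_alt.
  by rewrite (_ : 0%:M = 0) ?mul0mx //; apply/matrixP => i j; rewrite !mxE mul0rn.
by rewrite !mulmx0 addr0 -addrA vecF_addxx addr0.
Qed.

Lemma symplecticM (C D : 'M[F]_(n.*2)) :
  symplectic C -> symplectic D -> symplectic (C *m D).
Proof.
move=> /eqP hC /eqP hD; apply/eqP.
have -> : (C *m D)^T *m Rn *m (C *m D) = D^T *m (C^T *m Rn *m C) *m D.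
  by rewrite trmx_mul !mulmxA.
by rewrite hC hD.
Qed.

Lemma symplectic_unit (C : 'M[F]_(n.*2)) : symplectic C -> C \in unitmx.
Proof.
move=> /eqP hC; have := mulmx1_unit (A := Rn *m C^T *m Rn) (B := C).
by rewrite -!mulmxA (mulmxA C^T) hC Rmat_sqr => /(_ erefl) [].
Qed.

(** If [sform u v = 1], the transvection along [u + v] sends [u] to [v]; two of them suffice,
    through a vector pairing to 1 with both ends. *)
Lemma symplectic_trans (x y : vec) : x != 0 -> y != 0 ->
  exists2 C, symplectic C & C *m x = y.
Proof.
have step (u v : vec) : sform u v = 1 -> transvection (u + v) *m u = v.
  move=> uv; rewrite transvectionE sformDl sform_alt add0r sformC uv scale1r.
  by rewrite addrA vecF_addxx add0r.
(* Take a partner [z] of [x] and a partner [t] of [y]: if neither serves both ends, their sum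
   does. *)
move=> x0 y0; have [z zx zy] : exists2 z, sform x z = 1 & sform z y = 1.
  have [z hz] := sform_nondeg x x0; have [t ht] := sform_nondeg y y0.
  have [zy|zy] := eqVneq (sform y z) 1; first by exists z => //; rewrite sformC.
  have [tx|tx] := eqVneq (sform x t) 1; first by exists t => //; rewrite sformC.
  move: zy tx; rewrite -!F2_neq0 !negbK => /eqP zy /eqP tx.
  exists (z + t); first by rewrite sformDr hz tx addr0.
  by rewrite sformC sformDr zy ht add0r.
exists (transvection (z + y) *m transvection (x + z)).
  by apply: symplecticM; exact: transvection_symplectic.
by rewrite -mulmxA step // step.
Qed.

Lemma card_ker_syndmat (m : nat) : (m <= n.*2)%N ->
  #|[set u : vec | syndmat m n.*2 *m u == 0]| = (2 ^ (n.*2 - m))%N.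
Proof.
move=> mn; pose A := [set i : 'I_(n.*2) | (m <= i)%N].
have <- : #|A| = (n.*2 - m)%N.
  have fN (j : 'I_(n.*2 - m)) : (m + j < n.*2)%N by have := ltn_ord j; lia.
  pose f j := Ordinal (fN j).
  have finj : injective f by move=> i j /(congr1 val) /= /addnI /val_inj.
  rewrite -[RHS]card_ord -cardsT -(card_imset _ finj).
  apply: eq_card => i; rewrite inE; apply/idP/imsetP.
    move=> mi; have hi : (i - m < n.*2 - m)%N by have := ltn_ord i; lia.
    by exists (Ordinal hi); rewrite ?inE //; apply/val_inj; rewrite /= subnKC.
  by case=> j _ -> /=; rewrite leq_addr.
rewrite -card_vec_support; apply: eq_card => u; rewrite !inE.
have sE (i : 'I_m) : (syndmat m n.*2 *m u) i 0 = u (widen_ord mn i) 0.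
  rewrite mxE (bigD1 (widen_ord mn i)) //= mxE eqxx mul1r big1 ?addr0 // => j ji.
  rewrite mxE (_ : (val i == val j) = false) ?mul0r //.
  by apply/negP => /eqP e; move: ji; rewrite -val_eqE /= e eqxx.
apply/eqP/forallP => [h j|h].
  apply/implyP; rewrite inE -ltnNge => jm.
  have := sE (Ordinal jm); rewrite h mxE => ->.
  by apply/eqP; congr (u _ 0); exact/val_inj.
apply/matrixP => i j; rewrite [j]ord1 sE mxE.
by apply/eqP/(implyP (h _)); rewrite inE -ltnNge /=.
Qed.

Definition sympl_set : {set 'M[F]_(n.*2)} := [set C | symplectic C].

(* Transitivity on nonzero vectors makes the number of bad C independent of w. *)
Lemma symplectic_collision (m : nat) (w : vec) : (m <= n.*2)%N -> w != 0 ->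
  (#|[set C in sympl_set | syndmat m n.*2 *m C *m w == 0%R]| * 2 ^ m
    <= #|sympl_set|)%N.
Proof.
move=> mn w0; pose N (u : vec) := #|[set C in sympl_set | syndmat m n.*2 *m C *m u == 0]|.
have Nle (x y : vec) : x != 0 -> y != 0 -> (N y <= N x)%N.
  move=> x0 y0; have [g gs gx] := symplectic_trans x y x0 y0.
  (* Right multiplication by [g] injects the matrices bad for [y] into those bad for [x]. *)
  rewrite /N -(card_in_imset (f := fun C => C *m g)) => [|C D _ _ /= e]; last first.
    by rewrite -(mulmxK (symplectic_unit g gs) C) e mulmxK // symplectic_unit.
  apply: subset_leq_card; apply/fintype.subsetP => D /imsetP[C].
  rewrite !inE => /andP[Cs Cy] ->; rewrite symplecticM //=.
  by rewrite -!mulmxA gx !mulmxA.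
have Neq u : u != 0 -> N u = N w.
  by move=> u0; apply/eqP; rewrite eqn_leq !Nle.
(* Double counting of bad pairs: each invertible [C] kills exactly [2 ^ (n.*2 - m) - 1] nonzero
   vectors. *)
have sumN : (\sum_(u : vec | u != 0%R) N u = #|sympl_set| * (2 ^ (n.*2 - m) - 1))%N.
  under eq_bigr => u _.
    rewrite /N -sum1_card big_mkcond /=.
    over.
  rewrite exchange_big /= -sum1_card big_distrl /= [RHS]big_mkcond /=.
  apply: eq_bigr => C _; case: ifP => Cs; last first.
    by rewrite big1 // => u _; rewrite inE Cs.
  rewrite -big_mkcondr sum1_card mul1n -card_ker_syndmat //.
  have Cu : C \in unitmx by move: Cs; rewrite inE; exact: symplectic_unit.
  have Cinj : injective (fun u : vec => C *m u).
    by move=> u v /= e; rewrite -(mulKmx Cu u) e mulKmx.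
  rewrite (cardsD1 0 [set u | _]) inE mulmx0 eqxx addKn.
  rewrite -(card_imset _ Cinj).
  apply: eq_card => u; apply/imsetP/idP.
    case=> v; rewrite unfold_in /= !inE => /andP[v0 /andP[_ h]] ->.
    rewrite mulmxA h andbT.
    by apply: contraNneq v0 => e; rewrite -(mulKmx Cu v) e mulmx0.
  rewrite !inE => /andP[u0 h]; exists (invmx C *m u); last by rewrite mulKVmx.
  rewrite unfold_in /= inE -mulmxA mulKVmx // h Cs !andbT.
  by apply: contraNneq u0 => e; rewrite -(mulKVmx Cu u) e mulmx0.
move: sumN; rewrite (eq_bigr (fun=> N w)) => [|u]; last exact: Neq.
rewrite sum_nat_const.
have -> : #|[pred u : vec | u != 0]| = (2 ^ n.*2 - 1)%N.
  have : #|{: vec}| = (2 ^ n.*2)%N by rewrite card_mx muln1; congr expn; exact: card_Fp.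
  by rewrite (cardC1 (0 : vec)) => ->; rewrite subn1.
rewrite -/(N w) => e.
have wn : (1 < 2 ^ n.*2)%N.
  rewrite -[1%N]/(2 ^ 0)%N ltn_exp2l // lt0n.
  apply: contraNneq w0 => n0; apply/eqP/matrixP => i j.
  by have := ltn_ord i; rewrite [X in (_ < X)%N]n0.
have e2 : (2 ^ n.*2 = 2 ^ (n.*2 - m) * 2 ^ m)%N by rewrite -expnD subnK.
have d0 : (0 < 2 ^ (n.*2 - m))%N by rewrite expn_gt0.
have m0 : (0 < 2 ^ m)%N by rewrite expn_gt0.
rewrite -(leq_pmul2l (_ : 0 < 2 ^ n.*2 - 1)%N); last by lia.
rewrite mulnA e; nia.
Qed.

End Symplectic.

(** * Decoding *)

Section Guessing.
Context {R : realType}.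
Variables (n : nat) (delta : R).
Hypothesis d01 : 0 <= delta <= 1.
Local Notation pUV := (pUV_erasure n delta).

Lemma channel_weight_ge0 (w : nat) : 0 <= delta ^+ w * (1 - delta) ^+ (n - w).
Proof.
by case/andP: d01 => d0 d1; rewrite mulr_ge0 // exprn_ge0 // subr_ge0.
Qed.

Lemma sum_pUV (v : vecF n) (P : pred (vecF n.*2)) :
  \sum_u (if P u then pUV u v else 0) =
  delta ^+ wt v * (1 - delta) ^+ (n - wt v) *
    (#|[set u | compat u v && P u]|%:R / 4 ^+ wt v).
Proof.
rewrite -sum1_card natr_sum mulr_suml mulr_sumr big_mkcond [RHS]big_mkcond /=.
apply: eq_bigr => u _; rewrite inE pUV_erasureE.
by case: (P u); case: compat => //=; rewrite ?mul1r ?mulr0.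
Qed.

(* For fixed v the decoder takes at most 2^m values, hence is right for at most 2^m of the 4^|v| vectors. *)
Lemma err_guess_ge (m : nat) (C : 'M[F]_(n.*2)) (D : vecF n -> vecF m -> vecF n.*2) :
  bexp n delta (fun w => (m./2 < w)%N%:R * (1 - 2 ^+ m / 4 ^+ w))
    <= err_guess pUV C D.
Proof.
rewrite /bexp -(sum_wt _ n (fun w => delta ^+ w * (1 - delta) ^+ (n - w)
  * ((m./2 < w)%N%:R * (1 - 2 ^+ m / 4 ^+ w)))).
apply: ler_sum => v _; rewrite sum_pUV ler_wpM2l ?channel_weight_ge0 //.
set S := [set u | _].
have w0 : (0 : R) < 4 ^+ wt v by rewrite exprn_gt0.
rewrite ltnNge -pow4_le2 -ltnNge; case: ltnP => h; last first.
  by rewrite mul0r divr_ge0 // ltW.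
rewrite mul1r ler_pdivlMr // mulrBl mul1r divfK ?gt_eqF //.
rewrite -!natrX -natrB; last exact: ltnW.
rewrite ler_nat leq_subLR -(card_compat n v).
pose I := [set D v x | x : vecF m].
have cI : (#|I| <= 2 ^ m)%N.
  apply: leq_trans (leq_imset_card _ _) _.
  rewrite card_mx muln1 leq_eqVlt; apply/orP; left; apply/eqP; congr expn; exact: card_Fp.
apply: leq_trans (_ : (#|I :|: S| <= _)%N); last first.
  by apply: leq_trans (leq_card_setU _ _) _; rewrite leq_add2r.
apply: subset_leq_card; apply/fintype.subsetP => u; rewrite !inE => cu.
rewrite cu /=; case: eqVneq => [e|_]; last by rewrite orbT.
by rewrite orbF -e; apply/imsetP; exists (syndmat m n.*2 *m C *m u).
Qed.

(** The default 0 is reached only on syndromes produced by no compatible vector. *)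
Definition consistent_decoder (m : nat) (C : 'M[F]_(n.*2)) (v : vecF n) (s : vecF m) :
    vecF n.*2 :=
  odflt 0 [pick u | compat u v && (syndmat m n.*2 *m C *m u == s)].

Definition collisions (m : nat) (C : 'M[F]_(n.*2)) (v : vecF n) (u : vecF n.*2) :=
  [set u' | [&& compat u' v, u' != u & syndmat m n.*2 *m C *m (u' - u) == 0]].

(** A wrong answer of the decoder is itself a collision with the true vector. *)
Lemma consistent_decoder_err (m : nat) (C : 'M[F]_(n.*2)) (v : vecF n) u :
  compat u v ->
  ((consistent_decoder m C v (syndmat m n.*2 *m C *m u) != u)
    <= #|collisions m C v u|)%N.
Proof.
move=> cu; rewrite /consistent_decoder; case: pickP => [u' /andP[cu' /eqP e]|/(_ u)].
  rewrite /=; have [//|ne] := eqVneq u' u.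
  rewrite card_gt0; apply/set0Pn; exists u'.
  by rewrite inE cu' ne mulmxBr e subrr eqxx.
by rewrite cu eqxx.
Qed.

(** Union bound, summed over all symplectic matrices: each of the other [4 ^ wt v - 1] candidates
    collides with [u] for at most a fraction [2 ^- m] of them. *)
Lemma sum_collisions (m : nat) (v : vecF n) u : (m <= n.*2)%N -> compat u v ->
  ((\sum_(C in sympl_set n) #|collisions m C v u|) * 2 ^ m
    <= (4 ^ wt v - 1) * #|sympl_set n|)%N.
Proof.
move=> mn cu.
under eq_bigr => C _ do rewrite -sum1_card big_mkcond /=.
rewrite exchange_big /= -card_compat.
rewrite (cardsD1 u [set u | _]) inE cu addKn -sum1_card !big_distrl /=.
rewrite [X in (_ <= X)%N]big_mkcond /=; apply: leq_sum => u' _.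
rewrite !inE; case: (boolP (_ && _)) => [/andP[ne cu']|h]; last first.
  rewrite big1 // => C _; rewrite inE.
  by move: h; case: compat; case: (u' != u).
rewrite mul1n; apply: leq_trans (symplectic_collision n m (u' - u) mn _); last first.
  by rewrite subr_eq0.
rewrite leq_mul2r; apply/orP; right; rewrite -big_mkcondr sum1dep_card.
rewrite leq_eqVlt; apply/orP; left; apply/eqP; apply: eq_card => C.
by rewrite !inE cu' ne.
Qed.

Lemma symplectic1 : symplectic (1%:M : 'M[F]_(n.*2)).
Proof. by rewrite /symplectic trmx1 mul1mx mulmx1. Qed.

Lemma exists_symplectic_code (m : nat) : (m <= n.*2)%N ->
  exists2 C : 'M[F]_(n.*2), symplectic C &
    err_guess pUV C (consistent_decoder m C) <=
    bexp n delta (fun w => if (m./2 < w)%N then 1 else (4 ^+ w - 1) / 2 ^+ m).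
Proof.
move=> mn; set g := fun w : nat => _.
pose W (v : vecF n) : R := delta ^+ wt v * (1 - delta) ^+ (n - wt v).
pose D C := consistent_decoder m C.
(* Averaging, by contradiction: if every symplectic matrix exceeded the bound, so would the sum over
   the group, which is nonempty as it contains the identity. *)
apply: contrapT => none.
have gt C : C \in sympl_set n -> bexp n delta g < err_guess pUV C (D C).
  rewrite inE => Cs; rewrite ltNge; apply/negP => h.
  by apply: none; exists C.
have : \sum_(C in sympl_set n) bexp n delta g
     < \sum_(C in sympl_set n) err_guess pUV C (D C).
  apply: ltr_sum; last by move=> C /gt.
  by apply/hasP; exists 1%:M; rewrite ?mem_index_enum // inE symplectic1.
apply/negP; rewrite -leNgt sumr_const.
rewrite /bexp -(sum_wt _ n (fun w => delta ^+ w * (1 - delta) ^+ (n - w) * g w)).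
rewrite exchange_big /= -sumrMnl; apply: ler_sum => v _.
under eq_bigr => C _ do rewrite sum_pUV.
rewrite -mulr_sumr -mulrnAr ler_wpM2l ?channel_weight_ge0 //.
rewrite -mulr_suml -natr_sum ler_pdivrMr ?exprn_gt0 //.
pose a := #|sympl_set n|.
have cE C : #|[set u | compat u v && (D C v (syndmat m n.*2 *m C *m u) != u)]| =
    (\sum_(u | compat u v) (D C v (syndmat m n.*2 *m C *m u) != u))%N.
  rewrite -sum1_card big_mkcond [RHS]big_mkcond /=; apply: eq_bigr => u _.
  by rewrite inE; case: compat => //=; case: eqP.
rewrite /g -/a; case: ltnP => h.
  rewrite -natrX -natrM ler_nat -(card_compat n v).
  rewrite -sum_nat_const; apply: leq_sum => C _; apply: subset_leq_card.
  by apply/fintype.subsetP => u; rewrite !inE => /andP[].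
under eq_bigr => C _ do rewrite cE.
have m0 : (0 : R) < 2 ^+ m by rewrite exprn_gt0.
rewrite -(ler_pM2r m0).
have -> : ((4 ^+ wt v - 1) / 2 ^+ m *+ a) * 4 ^+ wt v * 2 ^+ m =
    (4 ^+ wt v - 1) * a%:R * 4 ^+ wt v :> R.
  by rewrite -mulr_natr; field; rewrite gt_eqF.
rewrite -!natrX -[1]/(1%:R) -natrB ?expn_gt0 // -!natrM ler_nat.
rewrite exchange_big /= big_distrl /=.
apply: leq_trans (_ : \sum_(u | compat u v) (4 ^ wt v - 1) * a <= _)%N; last first.
  rewrite sum_nat_const mulnC -card_compat leq_mul2l; apply/orP; right.
  by apply: subset_leq_card; apply/fintype.subsetP => u; rewrite inE.
apply: leq_sum => u cu; apply: leq_trans (sum_collisions m v u mn cu).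
rewrite leq_mul2r; apply/orP; right; apply: leq_sum => C _.
exact: consistent_decoder_err.
Qed.

Lemma feasible_ach (m : nat) (eps : R) : (m <= n.*2)%N ->
  bexp n delta (fun w => if (m./2 < w)%N then 1 else (4 ^+ w - 1) / 2 ^+ m) <= eps ->
  feasible m pUV eps.
Proof.
move=> mn h; have [C Cs hC] := exists_symplectic_code m mn.
by exists C; split=> //; exists (consistent_decoder m C); exact: le_trans h.
Qed.

Lemma feasible_conv (m : nat) (eps : R) : feasible m pUV eps ->
  bexp n delta (fun w => (m./2 < w)%N%:R * (1 - 2 ^+ m / 4 ^+ w)) <= eps.
Proof. by case=> C [_ [D h]]; exact: le_trans (err_guess_ge m C D) h. Qed.

Lemma feasible_full (eps : R) : 0 <= eps -> feasible n.*2 pUV eps.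
Proof.
move=> e0; exists 1%:M; split; first exact: symplectic1.
exists (fun _ s => s); rewrite /err_guess big1 // => v _; rewrite big1 // => u _.
rewrite (_ : syndmat _ _ = 1%:M) ?mul1mx ?eqxx //.
by apply/matrixP => i j; rewrite !mxE.
Qed.

End Guessing.

Lemma R_guess_bounds (R : realType) (n : nat) (p : vecF n.*2 -> vecF n -> R)
    (eps M : R) (m0 : nat) : (0 < n)%N -> (m0 <= n.*2)%N ->
  feasible m0 p eps -> (forall m, feasible m p eps -> M <= m%:R) ->
  (n%:R - m0%:R) / n%:R <= R_guess n p eps <= (n%:R - M) / n%:R.
Proof.
move=> n0 mn hm0 hM; have n0' : (0 : R) < n%:R by rewrite ltr0n.
have m0n : (m0 < n.*2.+1)%N by rewrite ltnS.
apply/andP; split.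
  apply: (@le_bigmax_cond _ _ _ _ (Ordinal m0n)
    (fun m : 'I_(n.*2).+1 => `[< feasible m p eps >])
    (fun m : 'I_(n.*2).+1 => (n%:R - m%:R) / n%:R)).
  exact/asboolP.
apply/bigmax_leP; split.
  (* The default [-1] of the maximum also obeys the upper bound, because [M <= m0 <= 2n]. *)
  rewrite ler_pdivlMr // mulN1r lerBrDr addrC lerBlDr.
  apply: le_trans (hM _ hm0) _; rewrite -natrD ler_nat addnn //.
by move=> m /asboolP /hM h; rewrite ler_pM2r ?invr_gt0 // lerB.
Qed.

(** * The critical syndrome length *)

Section Asymptotics.
Context {R : realType}.

Lemma bexp_le_sum (n : nat) (p s : R) (g : nat -> R) : 0 <= p <= 1 -> 0 < s ->
  s ^+ 2 = n.+1%:R * p * (1 - p) -> (forall i, 0 <= g i) ->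
  bexp n p g <= s^-1 * \sum_(i < n.+1) g i.
Proof.
move=> p01 s0 s2 g0; rewrite mulr_sumr; apply: ler_sum => i _.
rewrite !mulrA; apply: ler_wpM2r => //; rewrite -mulrA.
apply: le_trans (bexp_pred1 n p s i p01 s0 s2).
rewrite /bexp (bigD1 i) //= eqxx mulr1 lerDl sumr_ge0 // => j _.
by case/andP: p01 => p0 p1; rewrite !mulr_ge0 ?exprn_ge0 ?subr_ge0.
Qed.

Lemma sum_inv4_gt (t N : nat) :
  \sum_(i < N) (t < i)%N%:R / 4 ^+ i = (4 ^- t - 4 ^- (maxn N.-1 t)) / 3 :> R.
Proof.
have e0 k : (4 : R) ^+ k != 0 by rewrite expf_neq0.
elim: N => [|N IH]; first by rewrite big_ord0 max0n subrr mul0r.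
rewrite big_ord_recr /= IH; case: (ltnP t N) => h.
  rewrite (maxn_idPl _); last by case: N h {IH}.
  case: N h {IH} => [//|N] _ /=.
  by rewrite exprS; field; rewrite !e0.
by rewrite (maxn_idPr _) ?mul0r ?addr0 // (leq_trans (leq_pred N)).
Qed.

Lemma sum_pow4_le (t N : nat) :
  \sum_(i < N) (i <= t)%N%:R * 4 ^+ i = (4 ^+ (minn N t.+1) - 1) / 3 :> R.
Proof.
elim: N => [|N IH]; first by rewrite big_ord0 min0n subrr mul0r.
rewrite big_ord_recr /= IH; case: (ltnP N t.+1) => h.
  rewrite ltnS in h; rewrite h (minn_idPl _); last by rewrite ltnS.
  by rewrite [4 ^+ N.+1]exprS /=; field.
by rewrite leqNgt h /= mul0r addr0 (minn_idPr _) // ltnW.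
Qed.

Lemma bexp_gt (n t : nat) (p : R) :
  bexp n p (fun w => (t < w)%N%:R) = 1 - bexp n p (fun w => (w < t.+1)%N%:R).
Proof.
rewrite -[X in X - _](bexp_cst n p 1) -bexpB; apply: eq_bexp => w.
by rewrite ltnS; case: ltnP => _ /=; rewrite ?subr0 ?subrr.
Qed.

(** The loss against the plain tail is a geometric series starting just above [m/2]; with point
    masses at most [1 / s], it costs at most [1 / s]. *)
Lemma conv_bound (n m : nat) (p s : R) : 0 <= p <= 1 -> 0 < s ->
  s ^+ 2 = n.+1%:R * p * (1 - p) ->
  1 - bexp n p (fun w => (w < m./2.+1)%N%:R) - s^-1 <=
  bexp n p (fun w => (m./2 < w)%N%:R * (1 - 2 ^+ m / 4 ^+ w)).
Proof.
move=> p01 s0 s2; rewrite -bexp_gt.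
have -> : bexp n p (fun w => (m./2 < w)%N%:R * (1 - 2 ^+ m / 4 ^+ w)) =
    bexp n p (fun w => (m./2 < w)%N%:R)
    - 2 ^+ m * bexp n p (fun w => (m./2 < w)%N%:R / 4 ^+ w).
  by rewrite -bexpZ -bexpB; apply: eq_bexp => w; ring.
rewrite lerD2l lerN2 -ler_pdivlMl ?exprn_gt0 //.
apply: le_trans (bexp_le_sum _ _ _ _ p01 s0 s2 _) _.
  by move=> i; rewrite divr_ge0 // exprn_ge0.
rewrite sum_inv4_gt mulrC ler_wpM2r ?invr_ge0 ?(ltW s0) //.
(* The factor 2 pays for odd [m]; the geometric sum is below [4 ^- m./2 / 3], so the product stays
   below 1. *)
have h : (2 : R) ^+ m <= 2 * 4 ^+ m./2.
  rewrite (_ : 2 * 4 ^+ m./2 = 2 ^+ (m./2.*2.+1)); last first.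
    by rewrite exprS -mul2n exprM; congr (_ * _ ^+ _); ring.
  by rewrite ler_weXn2l ?ler1n //; lia.
have e0 k : (0 : R) < 4 ^- k by rewrite invr_gt0 exprn_gt0.
have := e0 m./2; have := e0 (maxn n.+1.-1 m./2).
move=> h1 h2; apply: (le_trans (y := 4 ^- m./2 / 2)); first lra.
rewrite -invfM lef_pV2 ?posrE ?mulr_gt0 ?exprn_gt0 //; lra.
Qed.

(** Here the geometric series runs downwards from [t]; divided by [4 ^ t], its sum is at most [4/3],
    rounded up to 2. *)
Lemma ach_bound (n t : nat) (p s : R) : 0 <= p <= 1 -> 0 < s ->
  s ^+ 2 = n.+1%:R * p * (1 - p) ->
  bexp n p (fun w => if (t.*2./2 < w)%N then 1 else (4 ^+ w - 1) / 2 ^+ t.*2)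
  <= 1 - bexp n p (fun w => (w < t.+1)%N%:R) + 2 / s.
Proof.
move=> p01 s0 s2; rewrite -bexp_gt doubleK.
have e4 : (2 : R) ^+ t.*2 = 4 ^+ t by rewrite -mul2n exprM; congr (_ ^+ _); ring.
have e0 k : (0 : R) < 4 ^+ k by rewrite exprn_gt0.
apply: (@le_trans _ _ (bexp n p (fun w => (t < w)%N%:R + (4 ^- t) * ((w <= t)%N%:R * 4 ^+ w)))).
  apply: le_bexp => // w; rewrite e4; case: ltnP => _.
    by rewrite lerDl mul0r mulr0.
  rewrite add0r mul1r mulrC ler_wpM2l ?invr_ge0 ?ltW //; lra.
rewrite bexpD bexpZ lerD2l.
rewrite ler_pdivrMl //.
apply: le_trans (bexp_le_sum _ _ _ _ p01 s0 s2 _) _.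
  by move=> i; rewrite mulr_ge0 // ltW.
rewrite sum_pow4_le [2 / s]mulrC [4 ^+ t * _]mulrCA ler_wpM2l ?invr_ge0 ?(ltW s0) //.
have : (4 : R) ^+ minn n.+1 t.+1 <= 4 ^+ t.+1 by rewrite ler_weXn2l ?ler1n ?geq_minr.
by have := e0 t; rewrite exprS; lra.
Qed.

Lemma Phi_growth (y : R) : exists2 c : R, 0 < c & forall h, 0 <= h <= 1 ->
  Phi y + c * h <= Phi (y + h) /\ Phi (y - h) <= Phi y - c * h.
Proof.
exists (Num.min (phi (y - 1)) (phi (y + 1))); first by rewrite lt_min !phi_gt0.
move=> h /andP[h0 h1].
have key a : y - 1 <= a -> a + h <= y + 1 ->
    Num.min (phi (y - 1)) (phi (y + 1)) * h <= Phi (a + h) - Phi a.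
  move=> ya ay; have aah : a <= a + h by rewrite lerDl.
  have [c /andP[ac ca] ->] := MVT_is_derive _ _ _ _ aah (fun t _ => is_derive_Phi t).
  rewrite (_ : a + h - a = h); last by ring.
  by apply: ler_wpM2r => //; apply: phi_bound; apply/andP; split; lra.
have k1 : Num.min (phi (y - 1)) (phi (y + 1)) * h <= Phi (y + h) - Phi y.
  by apply: key; lra.
have k2 : Num.min (phi (y - 1)) (phi (y + 1)) * h <= Phi (y - h + h) - Phi (y - h).
  by apply: key; lra.
rewrite subrK in k2; split; lra.
Qed.

Lemma erasure_threshold (delta eps : R) : 0 < delta < 1 -> 0 < eps < 1 ->
  exists (K : R) (N : nat), forall n : nat, (N <= n)%N ->
  let X := 2 * (n%:R * delta
     - Phi_inv eps * Num.sqrt (delta * (1 - delta)) * Num.sqrt n%:R) in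
  exists m0 : nat, [/\ (m0 <= n.*2)%N,
    feasible m0 (pUV_erasure n delta) eps,
    m0%:R <= X + K &
    forall m, feasible m (pUV_erasure n delta) eps -> X - K <= m%:R].
Proof.
move=> p01' e01; have /andP[p0 p1] := p01'.
have p01 : 0 <= delta <= 1 by rewrite !ltW.
set z := Phi_inv eps; set sg := Num.sqrt _.
have q0 : 0 < 1 - delta by lra.
have d0 : 0 < delta * (1 - delta) by rewrite mulr_gt0.
have sg0 : 0 < sg by rewrite sqrtr_gt0.
have Pz : Phi (- z) = 1 - eps by rewrite PhiN Phi_invK.
have [c c0 grow] := Phi_growth (- z).
have [Kc Kc0 clt] := binomial_clt delta (`|z| + 2) p01'.
(* Moving the threshold by [K1] changes [Phi] by at least [(Kc + 2) / s]: [Kc / s] absorbs the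
   normal approximation and [2 / s] the excess in [ach_bound] or [conv_bound]. *)
pose K1 := (Kc + 2) / c.
have K10 : 0 < K1 by rewrite divr_gt0 // ltr_wpDl.
have cK1 : c * K1 = Kc + 2 by rewrite /K1 mulrC divfK ?gt_eqF.
pose L := sg * `|z| + K1 + 2.
have az0 : 0 <= sg * `|z| by rewrite mulr_ge0 // ltW.
have L0 : 0 < L by rewrite /L; lra.
(* Once [sqrt n.+1 >= Q], the real threshold [a1] is below [n.+1], [a2] is nonnegative, and the
   normalized shift [K1 / s] is at most 1. *)
pose Q := L / delta + L / (1 - delta) + L / sg.
have Q1 : 0 < L / delta by rewrite divr_gt0.
have Q2 : 0 < L / (1 - delta) by rewrite divr_gt0.
have Q3 : 0 < L / sg by rewrite divr_gt0.
(* The factor 2 passes from [|V|] to [m]; inside, 2 covers rounding and [delta], [|z| * sg] the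
   drift from [sqrt n.+1] to [sqrt n], and [K1] the shift. *)
exists (2 * (2 + `|z| * sg + K1)), (Num.truncn (Q ^+ 2)).+1.
move=> n Nn X.
pose r : R := Num.sqrt n.+1%:R; pose s := r * sg.
have r2 : r ^+ 2 = n.+1%:R by rewrite sqr_sqrtr.
have r1 : 1 <= r by rewrite -sqrtr1 ler_wsqrtr // ler1n.
have r0 : 0 < r by lra.
have Qr : Q <= r.
  rewrite -(ler_pXn2r (ltn0Sn 1)) ?nnegrE ?(ltW r0) //; last first.
    by rewrite /Q; clear -Q1 Q2 Q3; lra.
  rewrite r2; apply: le_trans (ltW (truncnS_gt _)) _.
  by rewrite ler_nat (leq_trans Nn).
have rp : L <= r * delta.
  by rewrite -ler_pdivrMr //; rewrite /Q in Qr; clear -Qr Q2 Q3; lra.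
have rq : L <= r * (1 - delta).
  by rewrite -ler_pdivrMr //; rewrite /Q in Qr; clear -Qr Q1 Q3; lra.
have rs : L <= s.
  by rewrite /s -ler_pdivrMr //; rewrite /Q in Qr; clear -Qr Q1 Q2; lra.
have s0 : 0 < s by exact: lt_le_trans rs.
have s2 : s ^+ 2 = n.+1%:R * delta * (1 - delta).
  by rewrite exprMn r2 sqr_sqrtr ?(ltW d0) // mulrA.
have rL : s * `|z| + K1 + 2 <= r * L.
  rewrite /L /s; have : 0 <= (r - 1) * (K1 + 2).
    by rewrite mulr_ge0 //; [clear -r1|clear -K10]; lra.
  by clear; lra.
have np : s * `|z| + K1 + 2 <= n.+1%:R * delta.
  by apply: le_trans rL _; rewrite -r2 expr2 -mulrA ler_wpM2l // ltW.
have nq : s * `|z| + K1 + 2 <= n.+1%:R * (1 - delta).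
  by apply: le_trans rL _; rewrite -r2 expr2 -mulrA ler_wpM2l // ltW.
have szP : - (s * `|z|) <= s * z <= s * `|z|.
  rewrite -mulrN !ler_wpM2l ?(ltW s0) //; first exact: ler_norm.
  by rewrite lerNl -normrN ler_norm.
have /andP[sz1 sz2] := szP.
have h01 : 0 <= K1 / s <= 1.
  apply/andP; split; first by rewrite divr_ge0 // ltW.
  by rewrite ler_pdivrMr // mul1r; rewrite /L in rs; clear -rs az0; lra.
have /andP[h0 h1] := h01.
have [growU growL] := grow _ h01.
have cKs : c * (K1 / s) = Kc / s + 2 / s by rewrite mulrA cK1 mulrDl.
have is0 : 0 < s^-1 by rewrite invr_gt0.
have hs1 : K1 / s + s^-1 <= 1.
  rewrite (_ : K1 / s + s^-1 = (K1 + 1) / s); last by ring.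
  rewrite ler_pdivrMr // mul1r; rewrite /L in rs; clear -rs az0; lra.
have zn1 : - `|z| <= z by rewrite lerNl -normrN ler_norm.
have zn2 : z <= `|z| by exact: ler_norm.
pose y (k : nat) := (k%:R - n.+1%:R * delta) / s.
pose a1 := n.+1%:R * delta - s * z + K1.
pose a2 := n.+1%:R * delta - s * z - K1.
have a1E : (a1 - n.+1%:R * delta) / s = - z + K1 / s.
  by rewrite /a1; field; rewrite gt_eqF.
have a2E : (a2 - n.+1%:R * delta) / s = - z - K1 / s.
  by rewrite /a2; field; rewrite gt_eqF.
have a10 : 0 <= a1 by rewrite /a1; clear -np sz2 K10; lra.
have a20 : 0 <= a2 by rewrite /a2; clear -np sz2 K10; lra.
have yle (k : nat) (a : R) : k%:R <= a -> y k <= (a - n.+1%:R * delta) / s.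
  by move=> ka; rewrite /y ler_pM2r // lerB.
have yge (k : nat) (a : R) : a <= k%:R -> (a - n.+1%:R * delta) / s <= y k.
  by move=> ka; rewrite /y ler_pM2r // lerB.
have D1 (a : R) : (a + 1 - n.+1%:R * delta) / s = (a - n.+1%:R * delta) / s + s^-1.
  by field; rewrite gt_eqF.
have D2 (a : R) : (a - 1 - n.+1%:R * delta) / s = (a - n.+1%:R * delta) / s - s^-1.
  by field; rewrite gt_eqF.
have rn : 0 <= r - Num.sqrt n%:R <= 1.
  have sn0 := sqrtr_ge0 (n%:R : R).
  have sn2 : Num.sqrt (n%:R : R) ^+ 2 = n%:R by rewrite sqr_sqrtr.
  have rge : 0 <= r - Num.sqrt n%:R by rewrite subr_ge0 ler_wsqrtr // ler_nat.
  have e : (r - Num.sqrt n%:R) * (r + Num.sqrt n%:R) = 1.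
    by rewrite -subr_sqr r2 sn2 -natr1; ring.
  by rewrite rge /= -[X in _ <= X]e ler_peMr //; clear -r1 sn0; lra.
have drift : `|z * sg * (r - Num.sqrt n%:R)| <= `|z| * sg.
  have /andP[rn0 rn1] := rn.
  rewrite !normrM [`|sg|]gtr0_norm // [`|r - _|]ger0_norm //.
  by rewrite ler_piMr // mulr_ge0 // ltW.
have aX : n.+1%:R * delta - s * z = X / 2 + delta - z * sg * (r - Num.sqrt n%:R).
  by rewrite /X /s -natr1; field.
move: drift; rewrite ler_norml => /andP[drift1 drift2].
(* Achievability: [t.+1] lies above the shifted threshold, so the chance that [|V| <= t] is at least
   [1 - eps + 2 / s]. *)
pose t := Num.truncn a1.
have ta1 : t%:R <= a1 by rewrite truncn_le.
have a1t : a1 < t.+1%:R by exact: truncnS_gt.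
have tn : (t <= n)%N.
  rewrite -ltnS -(ltr_nat R); apply: le_lt_trans ta1 _.
  by rewrite /a1; clear -nq sz1; lra.
exists t.*2; split.
- by rewrite leq_double.
- apply: feasible_ach => //; first by rewrite leq_double.
  apply: le_trans (ach_bound n t delta s p01 s0 s2) _.
  have y1 : - z + K1 / s <= y t.+1 by rewrite -a1E; apply: yge; exact: ltW.
  have y2 : y t.+1 <= - z + K1 / s + s^-1.
    by rewrite -a1E -D1; apply: yle; rewrite -natr1; clear -ta1; lra.
  have yA : `|y t.+1| <= `|z| + 2.
    rewrite ler_norml; apply/andP; clear -y1 y2 hs1 h0 is0 zn1 zn2; split; lra.
  have := clt n t.+1 s s0 s2 yA; rewrite -/(y t.+1) ler_norml => /andP[b1 _].
  have := Phi_le _ _ y1; clear -b1 growU Pz cKs; lra.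
- rewrite -mul2n natrM; rewrite /a1 aX in ta1; clear -ta1 drift1 drift2 p0 p1 K10; lra.
move=> m /(feasible_conv _ _ p01) hm.
have hc := le_trans (conv_bound n m delta s p01 s0 s2) hm.
pose k := Num.truncn a2.
have ka2 : k%:R <= a2 by rewrite truncn_le.
have a2k : a2 < k.+1%:R by exact: truncnS_gt.
(* Converse: if [m./2 < k], then [|V| <= m./2] has probability at most [1 - eps - 2 / s], and
   [conv_bound] forces an error of at least [eps + 1 / s]. *)
have kt : (k <= m./2)%N.
  rewrite leqNgt; apply/negP => tk.
  have y1 : y k <= - z - K1 / s by rewrite -a2E; exact: yle.
  have y2 : - z - K1 / s - s^-1 <= y k.
    by rewrite -a2E -D2; apply: yge; rewrite -natr1 in a2k; clear -a2k; lra.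
  have yA : `|y k| <= `|z| + 2.
    rewrite ler_norml; apply/andP; clear -y1 y2 hs1 h0 is0 zn1 zn2; split; lra.
  have := clt n k s s0 s2 yA; rewrite -/(y k) ler_norml => /andP[_ b2].
  have mono : bexp n delta (fun w => (w < m./2.+1)%N%:R)
      <= bexp n delta (fun w => (w < k)%N%:R).
    by apply: le_bexp => // w; rewrite ler_nat; case: ltnP => //= wt; rewrite (leq_trans wt).
  have := Phi_le _ _ y1; clear -b2 mono growL Pz cKs hc is0; lra.
have km : (k.*2 <= m)%N by clear -kt; lia.
have : k.*2%:R <= m%:R :> R by rewrite ler_nat.
rewrite -mul2n natrM; rewrite /a2 aX -[k.+1%:R]natr1 in a2k.
clear -a2k drift1 drift2 p0 p1 K10; lra.
Qed.

(** * The degenerate channels [delta = 0] and [delta = 1] *)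

Lemma bexp_p0 (n : nat) (g : nat -> R) : bexp n 0 g = g 0.
Proof.
by elim: n => [|n IH]; rewrite ?bexp0 // bexpS IH mul0r add0r subr0 mul1r.
Qed.

Lemma bexp_p1 (n : nat) (g : nat -> R) : bexp n 1 g = g n.
Proof.
elim: n g => [|n IH] g; rewrite ?bexp0 // bexpS IH subrr mul0r addr0 mul1r //.
Qed.

Lemma feasible_noiseless (eps : R) : 0 <= eps -> forall n : nat,
  feasible 0 (pUV_erasure n (0 : R)) eps.
Proof.
move=> e0 n; apply: feasible_ach => //; first by rewrite lexx ler01.
by rewrite bexp_p0 /= !expr0 subrr mul0r.
Qed.

(** With everything erased, the converse reads [2 ^ (2n - m) <= 1 / (1 - eps)], and an exponent is
    at most its power of two. *)
Lemma feasible_fully_erased_ge (eps : R) : eps < 1 -> forall n m : nat,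
  feasible m (pUV_erasure n (1 : R)) eps -> 2 * n%:R - (1 - eps)^-1 <= m%:R.
Proof.
move=> e1 n m /feasible_conv; rewrite ler01 lexx bexp_p1 => /(_ isT).
have i0 : 0 < (1 - eps)^-1 by rewrite invr_gt0 subr_gt0.
have [mn|mn _] := ltnP m./2 n; last first.
  have : (n.*2 <= m)%N by lia.
  by rewrite -(ler_nat R) -mul2n natrM; lra.
rewrite mul1r => h; have mn' : (m <= n.*2)%N by lia.
have p0 : (0 : R) < 2 ^+ (n.*2 - m) by rewrite exprn_gt0.
have e : (2 : R) ^+ m / 4 ^+ n = (2 ^+ (n.*2 - m))^-1.
  rewrite (_ : (4 : R) ^+ n = 2 ^+ (n.*2 - m) * 2 ^+ m).
    by field; rewrite !expf_neq0.
  by rewrite -exprD subnK // -mul2n exprM; congr (_ ^+ _); ring.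
have : 2 ^+ (n.*2 - m) <= (1 - eps)^-1 :> R.
  by rewrite -[2 ^+ _]invrK lef_pV2 ?posrE ?invr_gt0 // ?subr_gt0 // -e; lra.
have : (n.*2 - m)%N%:R <= (2 : R) ^+ (n.*2 - m).
  by rewrite -natrX ler_nat ltnW // ltn_expl.
by rewrite natrB // -mul2n natrM; lra.
Qed.

End Asymptotics.

Theorem theorem8 (R : realType) (delta : R) (hdelta : 0 <= delta <= 1) :
  (forall (n k : nat), (k <= n)%N ->
     let m := (n - k)%N in
     let i0 : int := (n%:Z - (m./2)%:Z - 1)%R in
     forall rk : vecF n -> vecF n.*2 -> nat,
     rank_order (pUV_erasure n delta) rk ->
     eps_conv m (pUV_erasure n delta) rk =
       Bcdf n (1 - delta) i0
       - (2 ^ m)%N%:R * ((4 - 3 * delta) / 4) ^+ n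
         * Bcdf n ((4 - 4 * delta) / (4 - 3 * delta)) i0
     /\
     eps_ach m (pUV_erasure n delta) rk =
       (1 + ((2 ^ m.+1)%N%:R)^-1) * Bcdf n (1 - delta) i0
       - ((2 ^ m.+1)%N%:R)^-1
       - ((2 ^ m)%N%:R + 1) / 2 * ((4 - 3 * delta) / 4) ^+ n
         * Bcdf n ((4 - 4 * delta) / (4 - 3 * delta)) i0
       + (1 + 3 * delta) ^+ n / (2 ^ m.+1)%N%:R
         * Bcdf n (4 * delta / (1 + 3 * delta)) (m./2)%:Z)
  /\
  (forall eps : R, 0 < eps < 1 ->
     exists (K : R) (N : nat), forall n : nat, (N <= n)%N ->
       `| R_guess n (pUV_erasure n delta) eps
          - (1 - 2 * delta
             + 2 * Phi_inv eps * Num.sqrt (delta * (1 - delta))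
               / Num.sqrt n%:R) | <= K / n%:R).
Proof.
split=> [n k kn m i0 rk hrk|eps eps01].
  by apply: erasure_eps_formulas => //; exact: leq_subr.
have /andP[e0 e1] := eps01.
have [K [N thr]] : exists (K : R) (N : nat), forall n : nat, (N <= n)%N ->
  let X := 2 * (n%:R * delta
     - Phi_inv eps * Num.sqrt (delta * (1 - delta)) * Num.sqrt n%:R) in
  exists m0 : nat, [/\ (m0 <= n.*2)%N,
    feasible m0 (pUV_erasure n delta) eps,
    m0%:R <= X + K &
    forall m, feasible m (pUV_erasure n delta) eps -> X - K <= m%:R].
  have /andP[d0 d1] := hdelta.
  move: d0 d1; rewrite !le_eqVlt => /orP[/eqP <- _|d0 /orP[/eqP ->|d1]].
  - exists 0, 0%N => n _ X; exists 0%N.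
    have X0 : X = 0 by rewrite /X mul0r sqrtr0 !mulr0 mul0r subrr mulr0.
    rewrite X0 addr0 subr0; split=> //.
    by apply: feasible_noiseless; exact: ltW.
  - exists (1 - eps)^-1, 0%N => n _ X; exists n.*2.
    have XE : X = 2 * n%:R by rewrite /X subrr mulr0 sqrtr0 mulr0 mul0r subr0 mulr1.
    rewrite XE; split=> //.
    + by apply: feasible_full; exact: ltW.
    + by rewrite -mul2n natrM lerDl invr_ge0 subr_ge0 ltW.
    + exact: feasible_fully_erased_ge.
  by apply: erasure_threshold => //; rewrite d0.
exists K, N.+1 => n Nn; have n0 : (0 < n)%N by exact: leq_trans Nn.
have [m0 [m0n fm0 m0X hX]] := thr n (ltnW Nn).
have := R_guess_bounds R n _ eps _ m0 n0 m0n fm0 hX.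
set X := 2 * _ in m0X hX *.
have nR : (0 : R) < n%:R by rewrite ltr0n.
have sn0 : Num.sqrt (n%:R : R) != 0 by rewrite gt_eqF // sqrtr_gt0.
(* [X] is the syndrome length whose rate [(n - X) / n] is exactly the predicted one, so an error [K]
   in the length becomes [K / n] in the rate. *)
have -> : 1 - 2 * delta + 2 * Phi_inv eps * Num.sqrt (delta * (1 - delta))
    / Num.sqrt n%:R = (n%:R - X) / n%:R.
  have n_sqr : (n%:R : R) = Num.sqrt n%:R ^+ 2 by rewrite sqr_sqrtr // ltW.
  rewrite /X; move: (Num.sqrt n%:R) sn0 n_sqr => q q0 ->.
  by field.
move=> /andP[lo hi]; rewrite ler_norml -mulNr.
have lo' : (n%:R - X - K) / n%:R <= (n%:R - m0%:R) / n%:R.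
  by rewrite ler_pM2r ?invr_gt0 //; lra.
have hi' : (n%:R - (X - K)) / n%:R = (n%:R - X) / n%:R + K / n%:R by ring.
have lo2 : (n%:R - X - K) / n%:R = (n%:R - X) / n%:R - K / n%:R by ring.
by apply/andP; split; lra.
Qed.
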